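(* The edge generating series of the Schröder lattices is $$\sum_{n\ge0}\ell(\mathcal{S}_n)x^n=\frac{(1-x)\big(1-4x+x^2-(1-x)\sqrt{1-6x+x^2}\big)}{2x\sqrt{1-6x+x^2}}.$$ Moreover, for $n\ge1$, $\ell(\mathcal{S}_n)=d_n-r_n-d_{n-1}+r_{n-1}$, and for $n\ge0$ $$\ell(\mathcal{S}_n)=\sum_{k=0}^n\left(\!\!\binom{2k}{n-k}\!\!\right)\binom{2k}{k}\frac{k}{k+1},$$ where $\left(\!\binom{m}{j}\!\right)=\frac{m(m+1)\cdots(m+j-1)}{j!}$ is the multiset coefficient. Finally, $\ell(\mathcal{S}_n)\sim\frac{(1+\sqrt2)^{2n}}{\sqrt{\sqrt2\,n\pi}}$ and $i(\mathcal{S}_n)=\ell(\mathcal{S}_n)/|\mathcal{S}_n|\sim(2-\sqrt2)n$.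
   Context: Steps: $U=(1,1)$, $D=(1,-1)$, $H=(2,0)$. $\mathcal{S}_n$ is the set of Schröder paths of semi-length $n$ (lattice paths from $(0,0)$ to $(2n,0)$ with steps $U,D,H$ never going below the $x$-axis), partially ordered by $\gamma_1\le\gamma_2$ iff $\gamma_1$ lies weakly below $\gamma_2$. $\ell(P)$ is the number of edges (covering pairs) of the Hasse diagram of a finite poset $P$ and $i(P)=\ell(P)/|P|$. $d_n$ are the central Delannoy numbers, $\sum_n d_nx^n=1/\sqrt{1-6x+x^2}$, and $r_n=|\mathcal{S}_n|$ are the large Schröder numbers, $\sum_nr_nx^n=(1-x-\sqrt{1-6x+x^2})/(2x)$. $a_n\sim b_n$ means $a_n/b_n\to1$. *)

(* Defs.v *)
From Stdlib Require Import Reals ZArith Arith List Bool.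
Import ListNotations.
Open Scope bool_scope.

Inductive step : Set := U | D | H.

Definition step_eqb (a b : step) : bool :=
  match a, b with U, U | D, D | H, H => true | _, _ => false end.

Fixpoint path_eqb (p q : list step) : bool :=
  match p, q with
  | [], [] => true
  | a :: p', b :: q' => step_eqb a b && path_eqb p' q'
  | _, _ => false
  end.

(* Heights of the lattice path at the integer abscissae after the start,
   starting from height h.  An H step (2,0) contributes two points. *)
Fixpoint hts (h : Z) (p : list step) : list Z :=
  match p with
  | [] => []
  | U :: p' => (h + 1)%Z :: hts (h + 1)%Z p'
  | D :: p' => (h - 1)%Z :: hts (h - 1)%Z p'
  | H :: p' => h :: h :: hts h p'
  end.

Definition heights (p : list step) : list Z := 0%Z :: hts 0%Z p.

Fixpoint width (p : list step) : nat :=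
  match p with
  | [] => 0
  | U :: p' | D :: p' => S (width p')
  | H :: p' => S (S (width p'))
  end.

Definition is_schroder (n : nat) (p : list step) : bool :=
  Nat.eqb (width p) (2 * n)
  && forallb (fun y => Z.leb 0 y) (heights p)
  && Z.eqb (last (heights p) 0%Z) 0%Z.

Fixpoint words (k : nat) : list (list step) :=
  match k with
  | O => [[]]
  | S k' => flat_map (fun w => [U :: w; D :: w; H :: w]) (words k')
  end.

(* S_n : the (duplicate-free) list of all Schröder paths of semi-length n *)
Definition schroder (n : nat) : list (list step) :=
  filter (is_schroder n) (flat_map words (seq 0 (S (2 * n)))).

(* gamma1 lies weakly below gamma2 (both piecewise linear with nodes at
   integer abscissae, so comparing heights at integer points suffices) *)
Definition le_path (p q : list step) : bool :=
  forallb (fun yz => Z.leb (fst yz) (snd yz)) (combine (heights p) (heights q)).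

Definition lt_path (p q : list step) : bool := le_path p q && negb (path_eqb p q).

Definition covers (n : nat) (p q : list step) : bool :=
  lt_path p q && negb (existsb (fun r => lt_path p r && lt_path r q) (schroder n)).

Definition ell (n : nat) : nat :=
  length (filter (fun pq => covers n (fst pq) (snd pq))
                 (list_prod (schroder n) (schroder n))).

Definition schroder_r (n : nat) : nat := length (schroder n).

Fixpoint binom (n k : nat) : nat :=
  match n, k with
  | _, O => 1
  | O, S _ => 0
  | S n', S k' => binom n' k' + binom n' (S k')
  end.

Definition delannoy (n : nat) : nat :=
  fold_right Nat.add 0 (map (fun k => binom n k * binom (n + k) k) (seq 0 (S n))).

Fixpoint rising (m : R) (j : nat) : R :=
  match j with
  | O => 1%R
  | S j' => (rising m j' * (m + INR j'))%R
  end.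

Definition multichoose (m j : nat) : R := (rising (INR m) j / INR (fact j))%R.

Definition edge_gf (x : R) : R :=
  ((1 - x) * (1 - 4 * x + x ^ 2 - (1 - x) * sqrt (1 - 6 * x + x ^ 2))
   / (2 * x * sqrt (1 - 6 * x + x ^ 2)))%R.

(* Main.v *)
From Coquelicot Require Import Coquelicot.
Require Import Defs.
From Stdlib Require Import Reals ZArith Arith List Bool Lia Lra Psatz Factorial Permutation.
Import ListNotations.

(** A path [q] covers [p] exactly when it is obtained from [p] by replacing one [H] by
    [UD] or one valley [DU] by [H], so [ell n] counts the horizontal steps and the valleys
    of all paths of semi-length [n]. The first-return decomposition then yields
    [L = x (R + 2 R L + L + R (R - 1 - x R))], where [R = 1 + x R + x R^2], so that
    [sqrt (1 - 6 x + x^2) = 1 - x - 2 x R] and [L = (1 - x) (1 / sqrt (1 - 6 x + x^2) - R)].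
    All identities between coefficients are read off from identities between the sums of
    the power series near [0]. The multiset formula follows from
    [d_n = sum_k C(n,k) C(n+k,k)] and [r_n = sum_k C(n,k) C(n+k,k) / (k+1)].
    For the asymptotics, [1 - 6 x + x^2 = (1 - a x) (1 - b x)] with [a, b = 3 +- 2 sqrt 2]
    writes [d_n] as a convolution of the numbers [C(2k,k) / 4^k], to which Wallis's estimate
    applies, and [2 (n+1) r_n = 3 d_n - d_(n-1)] transfers the result to [r_n]. *)

(** * Schröder paths as words *)

Local Open Scope nat_scope.

(** The two halves of the covering claim rest on different facts. The sum of the heights is an
    integer rank: a replacement raises it by exactly 1 and every strict inequality raises it, so a
    replacement is a cover. Conversely, if [p < q], some replacement in [p] must stay weakly below
    [q]; the delicate point is the midpoint of an [H], where lifting to a peak might overshoot [q],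
    and the parity of abscissa plus height rules this out. On the analytic side only a neighbourhood
    of 0 matters, so a crude radius suffices; what it must also secure is the sign of
    [1 - x - 2 x R], because the quadratic equation for [R] fixes the square root only up to sign.
    In the asymptotics [a b = 1] turns the weights [b^k a^(n-k)] into [a^n b^(2k)], so that small
    [k] dominate and the convolution approaches a convergent series at [b^2]. *)

Lemma path_eqb_spec p q : reflect (p = q) (path_eqb p q).
Proof.
  revert q; induction p as [|a p IH]; intros [|b q]; simpl; try (constructor; congruence).
  destruct (IH q) as [->|N]; destruct a, b; simpl; constructor; congruence.
Qed.

Fixpoint final (h : Z) (p : list step) : Z :=
  match p with
  | [] => h
  | U :: p' => final (h + 1) p'
  | D :: p' => final (h - 1) p'
  | H :: p' => final h p'
  end.

Lemma last_hts h p d : last (h :: hts h p) d = final h p.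
Proof.
  revert h; induction p as [|[] p IH]; intros h; [reflexivity| | |];
    cbn [hts final]; rewrite <- IH; reflexivity.
Qed.

Lemma length_hts h p : length (hts h p) = width p.
Proof. revert h; induction p as [|[] p IH]; intros h; simpl; rewrite ?IH; auto. Qed.

(** The first recorded height already separates the steps: it lies above, below or at the start for
    [U], [D], [H]. *)
Lemma hts_inj h p q : hts h p = hts h q -> p = q.
Proof.
  revert h q; induction p as [|s p IH]; intros h [|t q]; auto.
  - destruct t; discriminate.
  - destruct s; discriminate.
  - destruct s, t; simpl; intros E; injection E; intros; try lia; f_equal; eauto.
Qed.

(** Nonnegativity and the final return to 0 in one structural recursion: with heights in [nat], a
    [D] at height 0 is refused on the spot. *)
Fixpoint good (h : nat) (p : list step) : Prop :=
  match p with
  | [] => h = 0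
  | U :: p' => good (S h) p'
  | D :: p' => match h with 0 => False | S h' => good h' p' end
  | H :: p' => good h p'
  end.

Lemma good_spec h p :
  good h p <-> Forall (Z.le 0) (hts (Z.of_nat h) p) /\ final (Z.of_nat h) p = 0%Z.
Proof.
  revert h; induction p as [|[] p IH]; intros h; simpl.
  - split; [intros ->; auto | intros []; lia].
  - replace (Z.of_nat h + 1)%Z with (Z.of_nat (S h)) by lia.
    rewrite IH; rewrite Forall_cons_iff; intuition lia.
  - destruct h as [|h].
    + rewrite Forall_cons_iff; intuition lia.
    + replace (Z.of_nat (S h) - 1)%Z with (Z.of_nat h) by lia.
      rewrite IH; rewrite Forall_cons_iff; intuition lia.
  - rewrite IH; rewrite !Forall_cons_iff; intuition lia.
Qed.

Lemma in_words k w : In w (words k) <-> length w = k.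
Proof.
  revert w; induction k as [|k IH]; intros w; simpl.
  - destruct w; simpl; intuition discriminate.
  - rewrite in_flat_map; split.
    + intros [v [Hv Hw]]; apply IH in Hv; simpl in Hw.
      destruct Hw as [<-|[<-|[<-|[]]]]; simpl; auto.
    + destruct w as [|s w]; simpl; [discriminate|]; intros E.
      exists w; split; [apply IH; lia|]; destruct s; simpl; auto.
Qed.

Lemma length_words k : length (words k) = 3 ^ k.
Proof.
  induction k as [|k IH]; simpl; auto.
  rewrite <- IH; clear; induction (words k); simpl; lia.
Qed.

Lemma NoDup_flat_map {A B} (f : A -> list B) l :
  NoDup l -> (forall x, In x l -> NoDup (f x)) ->
  (forall x y b, In x l -> In y l -> In b (f x) -> In b (f y) -> x = y) ->
  NoDup (flat_map f l).
Proof.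
  induction 1 as [|x l Hx Hl IH]; simpl; intros Hf Hd; [constructor|].
  apply NoDup_app; [auto|apply IH; intros; eauto|].
  intros b Hb Hb'; apply in_flat_map in Hb' as [y [Hy Hby]].
  apply Hx; rewrite (Hd x y b); auto.
Qed.

Lemma NoDup_list_prod {A B} (l : list A) (l' : list B) :
  NoDup l -> NoDup l' -> NoDup (list_prod l l').
Proof.
  intros Hl Hl'; induction Hl as [|x l Hx Hl IH]; simpl; [constructor|].
  apply NoDup_app; auto.
  - apply FinFun.Injective_map_NoDup; auto; intros a b E; congruence.
  - intros [a b] I J; apply in_map_iff in I as [? [E _]]; apply in_prod_iff in J as [J _].
    congruence.
Qed.

Lemma NoDup_words k : NoDup (words k).
Proof.
  induction k as [|k IH]; simpl.
  - repeat constructor; auto.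
  - apply NoDup_flat_map; auto.
    + intros w _; repeat constructor; simpl; intuition discriminate.
    + intros v w u _ _; simpl; intros [<-|[<-|[<-|[]]]] [E|[E|[E|[]]]]; congruence.
Qed.

Lemma length_le_width p : length p <= width p.
Proof. induction p as [|[] p IH]; simpl; lia. Qed.

Lemma in_schroder n p : In p (schroder n) <-> width p = 2 * n /\ good 0 p.
Proof.
  unfold schroder, is_schroder, heights; rewrite filter_In, in_flat_map.
  rewrite !andb_true_iff, last_hts, Nat.eqb_eq, Z.eqb_eq, good_spec.
  rewrite forallb_forall, Forall_forall; change (Z.of_nat 0) with 0%Z.
  split.
  - intros [_ [[E F] L]]; repeat split; auto.
    intros y Hy; apply Z.leb_le, F; right; auto.
  - intros [E [F L]]; repeat split; auto.
    + exists (length p); split; [apply in_seq|apply in_words; auto].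
      pose proof (length_le_width p); lia.
    + intros y [<-|Hy]; apply Z.leb_le; [lia|auto].
Qed.

Lemma NoDup_schroder n : NoDup (schroder n).
Proof.
  apply NoDup_filter, NoDup_flat_map; [apply seq_NoDup|intros; apply NoDup_words|].
  intros x y b _ _ Hx Hy; apply in_words in Hx, Hy; congruence.
Qed.

(** All words of length at most [2 n] are counted. The bound serves only to give the power series a
    positive radius of convergence. *)
Lemma schroder_r_le n : schroder_r n <= 3 * 9 ^ n.
Proof.
  unfold schroder_r, schroder.
  eapply Nat.le_trans; [apply filter_length_le|].
  replace (9 ^ n) with (3 ^ (2 * n)) by (rewrite Nat.pow_mul_r; reflexivity).
  generalize (2 * n) as m; intros m.
  (* The geometric sum 1 + 3 + ... + 3^m, freed of division and subtraction. *)
  assert (E : 2 * length (flat_map words (seq 0 (S m))) + 1 = 3 * 3 ^ m); [|lia].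
  induction m as [|m IH]; [reflexivity|].
  rewrite seq_S, flat_map_app, length_app; cbn [flat_map]; rewrite app_nil_r, Nat.add_0_l, length_words.
  change (3 ^ S m) with (3 * 3 ^ m) in *; lia.
Qed.

Lemma length_list_prod_filter {A B} (f : A * B -> bool) l l' :
  length (filter f (list_prod l l')) =
  list_sum (map (fun a => length (filter (fun b => f (a, b)) l')) l).
Proof.
  induction l as [|a l IH]; simpl; auto.
  rewrite filter_app, length_app, IH; f_equal; clear IH.
  induction l' as [|b l' IH]; simpl; auto; destruct (f (a, b)); simpl; auto.
Qed.

Lemma ell_le n : ell n <= schroder_r n * schroder_r n.
Proof.
  unfold ell, schroder_r; eapply Nat.le_trans; [apply filter_length_le|].
  rewrite length_prod; auto.
Qed.

(** * The covering relation *)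

(* The paths obtained from [p] by one replacement [H -> UD] or [DU -> H]. *)
Fixpoint ups (p : list step) : list (list step) :=
  match p with
  | [] => []
  | s :: p' =>
      match s, p' with
      | H, _ => [U :: D :: p']
      | D, U :: p'' => [H :: p'']
      | _, _ => []
      end ++ map (cons s) (ups p')
  end.

Fixpoint deg (p : list step) : nat :=
  match p with
  | [] => 0
  | s :: p' =>
      match s, p' with
      | H, _ => 1
      | D, U :: _ => 1
      | _, _ => 0
      end + deg p'
  end.

Lemma length_ups p : length (ups p) = deg p.
Proof.
  induction p as [|s p IH]; auto.
  cbn [ups deg]; rewrite length_app, length_map, IH.
  destruct s, p as [|[] p]; reflexivity.
Qed.

Lemma ups_cons s p r : In r (ups p) -> In (s :: r) (ups (s :: p)).
Proof. intros I; cbn [ups]; apply in_or_app; right; apply in_map; auto. Qed.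

(** Turns membership in [ups] into an inductive relation, two local moves closed under a common
    prefix step, so that each invariant below is checked on the moves alone. *)
Lemma ups_ind (P : list step -> list step -> Prop) :
  (forall p, P (H :: p) (U :: D :: p)) ->
  (forall p, P (D :: U :: p) (H :: p)) ->
  (forall s p r, P p r -> P (s :: p) (s :: r)) ->
  forall p r, In r (ups p) -> P p r.
Proof.
  intros PH PD PC p; induction p as [|s p IH]; intros r; [intros []|].
  cbn [ups]; intros I; apply in_app_or in I as [I|I].
  - destruct s, p as [|[] p]; simpl in I; intuition; subst; auto.
  - apply in_map_iff in I as [q [<- Iq]]; auto.
Qed.

Lemma NoDup_ups p : NoDup (ups p).
Proof.
  induction p as [|s p IH]; [constructor|].
  cbn [ups]; apply NoDup_app.
  - destruct s, p as [|[] p]; repeat constructor; auto.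
  - apply FinFun.Injective_map_NoDup; auto; intros a b E; congruence.
  - intros r I J; apply in_map_iff in J as [q [<- _]].
    destruct s, p as [|[] p]; simpl in I; intuition discriminate.
Qed.

Notation Zle_list := (Forall2 Z.le).

Lemma Zle_list_refl l : Zle_list l l.
Proof. induction l; constructor; auto; lia. Qed.

Lemma ups_width p r : In r (ups p) -> width r = width p.
Proof. revert p r; refine (ups_ind _ _ _ _); auto; intros [] p r E; simpl; auto. Qed.

Lemma ups_final p r : In r (ups p) -> forall h, final h r = final h p.
Proof.
  revert p r; refine (ups_ind _ _ _ _); [| |intros [] p r E h; simpl; auto];
    intros p h; simpl; f_equal; lia.
Qed.

Lemma ups_hts p r : In r (ups p) -> forall h, Zle_list (hts h p) (hts h r).
Proof.
  revert p r; refine (ups_ind _ _ _ _).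
  - intros p h; simpl; repeat (apply Forall2_cons; [lia|]).
    replace (h + 1 - 1)%Z with h by lia; apply Zle_list_refl.
  - intros p h; simpl; repeat (apply Forall2_cons; [lia|]).
    replace (h - 1 + 1)%Z with h by lia; apply Zle_list_refl.
  - intros [] p r E h; simpl; repeat (apply Forall2_cons; [lia|]); auto.
Qed.

Definition Zsum (l : list Z) : Z := fold_right Z.add 0%Z l.

(** Either move changes a single recorded height: the midpoint of [H] goes from [h] to [h + 1], the
    bottom of a valley from [h - 1] to [h]. *)
Lemma ups_Zsum p r : In r (ups p) -> forall h, Zsum (hts h r) = (Zsum (hts h p) + 1)%Z.
Proof.
  revert p r; refine (ups_ind _ _ _ _).
  - intros p h; simpl; replace (h + 1 - 1)%Z with h by lia; lia.
  - intros p h; simpl; replace (h - 1 + 1)%Z with h by lia; lia.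
  - intros [] p r E h; simpl; rewrite E; lia.
Qed.

Lemma Zle_list_Zsum l l' :
  Zle_list l l' -> (Zsum l <= Zsum l')%Z /\ (Zsum l = Zsum l' -> l = l').
Proof.
  induction 1 as [|a b l l' Hab Hl [IH1 IH2]]; simpl; [auto with zarith|].
  split; [lia|]; intros E; f_equal; [|apply IH2]; lia.
Qed.

(* Height sequences of Schröder paths: the height drops by at most one at each
   abscissa, and at a point [(c, y)] with [c + y] odd (the middle of an [H] step)
   it does not change. *)
Fixpoint hseq (c y : Z) (l : list Z) : Prop :=
  match l with
  | [] => True
  | y' :: l' => (y - 1 <= y')%Z /\ (Z.Odd (c + y) -> y' = y) /\ hseq (c + 1) y' l'
  end.

Lemma hseq_hts c h p : Z.Even (c + h) -> hseq c h (hts h p).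
Proof.
  revert c h; induction p as [|s p IH]; intros c h E; [exact I|].
  assert (~ Z.Odd (c + h)) by (intros O; exact (Z.Even_Odd_False _ E O)).
  assert (Z.Even (c + 1 + 1 + h)) by (destruct E as [k E]; exists (k + 1)%Z; lia).
  destruct s; simpl; repeat split; try lia; try tauto; apply IH;
    destruct E as [k E]; [exists (k + 1)%Z|exists k|exists (k+1)%Z]; lia.
Qed.

(* Following a run of down steps of [p] strictly below [l], one meets a valley or
   a horizontal step, which can be raised: in the latter case the parity condition
   in [hseq] keeps [l] strictly above the middle of the step. *)
Lemma strict_below_raise p c h y l :
  Z.Even (c + h) -> (h < y)%Z -> hseq c y l -> Zle_list (hts h p) l ->
  final h p = last (y :: l) 0%Z ->
  exists r, In r (ups (D :: p)) /\ Zle_list (hts (h + 1) r) (y :: l).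
Proof.
  revert c h y l; induction p as [|s p IH]; intros c h y l E Hy Hs Hl Hf.
  - inversion Hl; subst; simpl in Hf; lia.
  - destruct s.
    + exists (H :: p); split; [cbn [ups]; apply in_or_app; left; simpl; auto|].
      inversion Hl; subst; simpl; constructor; [lia|]; constructor; auto.
    + inversion Hl as [|a b la lb Hab Hlb Ea Eb]; subst.
      destruct Hs as (Hs1 & Hs2 & Hs3).
      destruct (IH (c + 1)%Z (h - 1)%Z b lb) as [r [Ir Hr]]; auto.
      * replace (c + 1 + (h - 1))%Z with (c + h)%Z by lia; auto.
      * lia.
      * exists (D :: r); split; [apply ups_cons; auto|].
        replace (h - 1 + 1)%Z with h in Hr by lia.
        simpl; replace (h + 1 - 1)%Z with h by lia; constructor; auto; lia.
    + simpl in Hl; inversion Hl as [|a b la lb Hab Hlb Ea Eb]; subst.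
      inversion Hlb as [|a' b' la' lb' Hab' Hlb' Ea' Eb']; subst.
      exists (D :: U :: D :: p); split.
      * apply ups_cons; cbn [ups]; apply in_or_app; left; simpl; auto.
      * destruct Hs as (Hs1 & Hs2 & Hs3).
        simpl; replace (h + 1 - 1)%Z with h by lia; replace (h + 1 - 1)%Z with h by lia.
        constructor; [lia|]; constructor; [|constructor; auto].
        destruct (Z.eq_dec y (h + 1)) as [->|N]; [|lia].
        rewrite Hs2; [lia|]; destruct E as [k E]; exists k; lia.
Qed.

(** After the common prefix the steps of [p] and [q] must be [D]/[U], [D]/[H] or [H]/[U], since
    otherwise [p] is above [q] at once. An [H] under a [U] is lifted immediately; after a [D] the
    path [p] runs strictly below [q] and [strict_below_raise] applies. *)
Lemma raise_below p q h :
  Zle_list (hts h p) (hts h q) -> final h p = final h q -> p <> q ->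
  exists r, In r (ups p) /\ Zle_list (hts h r) (hts h q).
Proof.
  revert q h; induction p as [|s p IH]; intros q h Hl Hf N.
  - destruct q as [|[] q]; [congruence| | |]; inversion Hl.
  - assert (Same : forall q', q = s :: q' -> exists r, In r (ups (s :: p)) /\ Zle_list (hts h r) (hts h q)).
    { intros q' ->.
      assert (N' : p <> q') by congruence.
      destruct s; simpl in Hl, Hf;
        repeat match goal with X : Forall2 _ (_ :: _) _ |- _ => inversion X; subst; clear X end;
        match goal with X : Forall2 _ _ _ |- _ => destruct (IH _ _ X Hf N') as [r [Ir Hr]] end;
        eexists; (split; [apply ups_cons, Ir|]); simpl; repeat (apply Forall2_cons; [lia|]); auto. }
    destruct q as [|t q]; [destruct s; inversion Hl|].
    destruct s, t; try (eapply Same; reflexivity); simpl in Hl, Hf;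
      try (inversion Hl; lia).
    (* Only the parity of abscissa plus height matters, so the abscissa is normalised to [1 - h],
       which sums to 0 with the height [h - 1]. *)
    + destruct (strict_below_raise p (1 - h) (h - 1) (h + 1) (hts (h + 1) q)) as [r [Ir Hr]].
      * exists 0%Z; lia.
      * lia.
      * apply hseq_hts; exists 1%Z; lia.
      * inversion Hl; auto.
      * rewrite last_hts; auto.
      * exists r; split; auto; replace (h - 1 + 1)%Z with h in Hr by lia; auto.
    (* Here [q] is at the midpoint of its [H]: abscissa plus height is odd, and the next height is
       again [h], as [hseq] requires. *)
    + destruct (strict_below_raise p (1 - h) (h - 1) h (h :: hts h q)) as [r [Ir Hr]].
      * exists 0%Z; lia.
      * lia.
      * cbn [hseq]; split; [lia|split; [auto|]]; apply hseq_hts; exists 1%Z; lia.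
      * inversion Hl; auto.
      * rewrite Hf, <- (last_hts h q 0%Z); reflexivity.
      * exists r; split; auto; replace (h - 1 + 1)%Z with h in Hr by lia; auto.
    + exists (U :: D :: p); split; [cbn [ups]; left; auto|].
      inversion Hl; subst; simpl; constructor; [lia|].
      replace (h + 1 - 1)%Z with h by lia; auto.
Qed.

Lemma forallb_combine_Zle l l' : length l = length l' ->
  forallb (fun yz => Z.leb (fst yz) (snd yz)) (combine l l') = true <-> Zle_list l l'.
Proof.
  revert l'; induction l as [|a l IH]; intros [|b l'] E; try discriminate.
  - split; constructor.
  - simpl in *; rewrite andb_true_iff, Z.leb_le, IH by lia.
    split; [intros []; constructor; auto|intros X; inversion X; auto].
Qed.

Lemma le_path_spec p q : width p = width q ->
  le_path p q = true <-> Zle_list (hts 0 p) (hts 0 q).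
Proof.
  intros E; unfold le_path, heights; rewrite forallb_combine_Zle by (simpl; rewrite !length_hts; auto).
  split; [intros X; inversion X; auto|constructor; auto; lia].
Qed.

Lemma lt_path_spec p q : width p = width q ->
  lt_path p q = true <-> Zle_list (hts 0 p) (hts 0 q) /\ p <> q.
Proof.
  intros E; unfold lt_path; rewrite andb_true_iff, le_path_spec, negb_true_iff by auto.
  destruct (path_eqb_spec p q); intuition congruence.
Qed.

Lemma ups_schroder n p r : In p (schroder n) -> In r (ups p) -> In r (schroder n).
Proof.
  intros Ip Ir; apply in_schroder in Ip as [W G]; apply in_schroder.
  rewrite (ups_width _ _ Ir); split; auto.
  apply good_spec in G as [F E]; apply good_spec; rewrite (ups_final _ _ Ir); split; auto.
  pose proof (ups_hts _ _ Ir (Z.of_nat 0)) as Hl; revert Hl F.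
  generalize (hts (Z.of_nat 0) p), (hts (Z.of_nat 0) r).
  induction 1; intros F; inversion F; subst; constructor; auto; lia.
Qed.

Lemma lt_path_Zsum p q : width p = width q -> lt_path p q = true ->
  (Zsum (hts 0 p) < Zsum (hts 0 q))%Z.
Proof.
  intros W L; apply lt_path_spec in L as [L N]; auto.
  destruct (Zle_list_Zsum _ _ L) as [S1 S2].
  destruct (Z.eq_dec (Zsum (hts 0 p)) (Zsum (hts 0 q))) as [E|]; [|lia].
  destruct N; eapply hts_inj; eauto.
Qed.

Lemma ups_lt_path p r : In r (ups p) -> lt_path p r = true.
Proof.
  intros I; apply lt_path_spec; [rewrite (ups_width _ _ I); auto|].
  split; [apply ups_hts; auto|intros ->; pose proof (ups_Zsum _ _ I 0%Z); lia].
Qed.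

(** If [q] covers [p], the raise of [p] below [q] lies strictly above [p], hence is [q] itself.
    Conversely a raise adds 1 to [Zsum], which leaves no integer for a path strictly between. *)
Lemma covers_ups n p q : In p (schroder n) ->
  In q (schroder n) /\ covers n p q = true <-> In q (ups p).
Proof.
  intros Ip; unfold covers; rewrite andb_true_iff, negb_true_iff.
  pose proof (proj1 (in_schroder _ _) Ip) as [Wp Gp].
  split.
  - intros [Iq [L N]].
    pose proof (proj1 (in_schroder _ _) Iq) as [Wq Gq].
    apply lt_path_spec in L as [L Npq]; [|congruence].
    destruct (raise_below p q 0 L) as [r [Ir Hr]]; auto.
    { apply good_spec in Gp as [_ Gp]; apply good_spec in Gq as [_ Gq]; simpl in *; congruence. }
    destruct (path_eqb_spec r q) as [<-|Nrq]; auto.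
    assert (X : existsb (fun r => lt_path p r && lt_path r q) (schroder n) = true); [|congruence].
    apply existsb_exists; exists r; split; [apply (ups_schroder n p r); auto|].
    apply andb_true_iff; split; [apply ups_lt_path; auto|].
    apply lt_path_spec; auto; rewrite (ups_width _ _ Ir); congruence.
  - intros Iq; pose proof (ups_schroder n p q Ip Iq) as Sq; repeat split; auto.
    + apply ups_lt_path; auto.
    + destruct (existsb _ _) eqn:X; auto.
      apply existsb_exists in X as [r [Sr Hr]]; apply andb_true_iff in Hr as [L1 L2].
      apply in_schroder in Sr as [Wr _]; apply in_schroder in Sq as [Wq _].
      apply lt_path_Zsum in L1, L2; try congruence.
      pose proof (ups_Zsum _ _ Iq 0%Z); lia.
Qed.

Lemma ell_deg n : ell n = list_sum (map deg (schroder n)).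
Proof.
  unfold ell; rewrite length_list_prod_filter; f_equal; apply map_ext_in; intros p Ip.
  rewrite <- length_ups; apply Permutation_length, NoDup_Permutation.
  - apply NoDup_filter, NoDup_schroder.
  - apply NoDup_ups.
  - intros q; rewrite filter_In; apply covers_ups; auto.
Qed.

(** * First-return decomposition *)

Lemma width_app p q : width (p ++ q) = width p + width q.
Proof. induction p as [|[] p IH]; simpl; rewrite ?IH; auto. Qed.

Lemma good_app k p h q : good k p -> good h q -> good (k + S h) (p ++ D :: q).
Proof.
  revert k; induction p as [|[] p IH]; intros k Gp Gq; simpl in *.
  - subst; auto.
  - apply (IH (S k)); auto.
  - destruct k; [tauto|]; apply IH; auto.
  - auto.
Qed.

(** The cut is at the first passage below the starting level. After an initial [U] two cuts are
    made, the second one in the remainder left by the first, hence the induction on a length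
    bound. *)
Lemma good_split w h : good (S h) w ->
  exists p q, w = p ++ D :: q /\ good 0 p /\ good h q.
Proof.
  remember (length w) as m eqn:Em; assert (L : length w <= m) by lia; clear Em.
  revert w h L; induction m as [|m IH]; intros [|s w] h L G; simpl in L; try lia;
    try discriminate.
  destruct s; simpl in G.
  - destruct (IH w (S h)) as (p & q & -> & Gp & Gq); [lia|auto|].
    rewrite length_app in L; simpl in L.
    destruct (IH q h) as (p' & q' & -> & Gp' & Gq'); [lia|auto|].
    exists (U :: p ++ D :: p'), q'; repeat split; auto.
    + simpl; rewrite <- app_assoc; auto.
    + apply (good_app 0 p 0 p'); auto.
  - exists [], w; simpl; auto.
  - destruct (IH w h) as (p & q & -> & Gp & Gq); [lia|auto|].
    exists (H :: p), q; auto.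
Qed.

(** A [good] word ends at height 0 and never takes a [D] there, so it cannot continue past a [D]
    that follows another [good] word of the same starting height. *)
Lemma good_split_unique k p p' q q' : good k p -> good k p' ->
  p ++ D :: q = p' ++ D :: q' -> p = p' /\ q = q'.
Proof.
  revert k p'; induction p as [|s p IH]; intros k [|s' p'] Gp Gp' E; simpl in E.
  - injection E; auto.
  - injection E; intros; subst s'; simpl in Gp, Gp'; subst k; tauto.
  - injection E; intros; subst s; simpl in Gp, Gp'; subst k; tauto.
  - injection E; intros E' <-.
    assert (X : exists k', good k' p /\ good k' p').
    { destruct s; simpl in Gp, Gp'; eauto; destruct k; [tauto|eauto]. }
    destruct X as (k' & G & G'); destruct (IH k' p' G G' E') as [-> ->]; auto.
Qed.

Lemma good_width_even h p : good h p -> exists m, width p + h = 2 * m.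
Proof.
  revert h; induction p as [|[] p IH]; intros h G; simpl in *.
  - exists 0; lia.
  - destruct (IH _ G) as [m E]; exists m; lia.
  - destruct h; [tauto|]; destruct (IH _ G) as [m E]; exists (S m); lia.
  - destruct (IH _ G) as [m E]; exists (S m); lia.
Qed.

Definition join (pq : list step * list step) := U :: fst pq ++ D :: snd pq.

(** Both lists are free of duplicates, so comparing members suffices; on the right this uses the
    uniqueness of the cut and the first letter [H] or [U]. *)
Lemma schroder_succ n :
  Permutation (schroder (S n))
    (map (cons H) (schroder n) ++
     flat_map (fun i => map join (list_prod (schroder i) (schroder (n - i)))) (seq 0 (S n))).
Proof.
  apply NoDup_Permutation; [apply NoDup_schroder| |].
  - apply NoDup_app.
    + apply FinFun.Injective_map_NoDup; [intros a b E; congruence|apply NoDup_schroder].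
    + apply NoDup_flat_map; [apply seq_NoDup| |].
      * intros i Hi.
        apply NoDup_map_NoDup_ForallPairs; [|apply NoDup_list_prod; apply NoDup_schroder].
        intros [p q] [p' q'] I I' E; apply in_prod_iff in I as [I _], I' as [I' _].
        apply in_schroder in I as [_ I], I' as [_ I'].
        unfold join in E; simpl in E; injection E; intros E'.
        destruct (good_split_unique 0 p p' q q'); congruence.
      * intros i j r Hi Hj Ii Ij.
        apply in_map_iff in Ii as [[p q] [<- I]], Ij as [[p' q'] [E I']].
        apply in_prod_iff in I as [I _], I' as [I' _].
        apply in_schroder in I as [W I], I' as [W' I'].
        unfold join in E; simpl in E; injection E; intros E'.
        destruct (good_split_unique 0 p' p q' q) as [-> _]; auto; lia.
    + intros r I J; apply in_map_iff in I as [p [<- _]].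
      apply in_flat_map in J as [i [_ J]]; apply in_map_iff in J as [[] [E _]]; discriminate.
  - intros r; rewrite in_app_iff, in_map_iff, in_flat_map; split.
    + intros I; apply in_schroder in I as [W G].
      destruct r as [|[] r]; simpl in W, G; try lia; try tauto.
      * right; destruct (good_split r 0 G) as (p & q & -> & Gp & Gq).
        rewrite width_app in W; simpl in W.
        destruct (good_width_even _ _ Gp) as [i Ei].
        exists i; split; [apply in_seq; lia|]; apply in_map_iff; exists (p, q).
        split; auto; apply in_prod_iff; split; apply in_schroder; split; auto; lia.
      * left; exists r; split; auto; apply in_schroder; split; auto; lia.
    + intros [[p [<- I]]|[i [Hi I]]].
      * apply in_schroder in I as [W G]; apply in_schroder; split; auto; simpl; lia.
      * apply in_map_iff in I as [[p q] [<- I]]; apply in_prod_iff in I as [Ip Iq].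
        apply in_schroder in Ip as [Wp Gp], Iq as [Wq Gq]; apply in_seq in Hi.
        apply in_schroder; unfold join; simpl; split.
        -- rewrite width_app; simpl; lia.
        -- apply (good_app 0 p 0 q); auto.
Qed.

Definition start_U (p : list step) : nat := match p with U :: _ => 1 | _ => 0 end.

(** A [D] appended to [p] creates no valley; the returning [D] itself starts one exactly when [q]
    begins with [U]. *)
Lemma deg_join p q : deg (join (p, q)) = deg p + deg q + start_U q.
Proof.
  unfold join; simpl; induction p as [|s p IH].
  - destruct q as [|[] q]; simpl; lia.
  - cbn [deg app]; rewrite IH.
    destruct s, p as [|[] p]; simpl; lia.
Qed.

Lemma list_sum_perm l l' : Permutation l l' -> list_sum l = list_sum l'.
Proof. induction 1; simpl; lia. Qed.

Lemma list_sum_flat_map {A B} (f : B -> nat) (g : A -> list B) l :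
  list_sum (map f (flat_map g l)) = list_sum (map (fun x => list_sum (map f (g x))) l).
Proof. induction l as [|a l IH]; simpl; auto; rewrite map_app, list_sum_app, IH; auto. Qed.

Lemma list_sum_list_prod {A B} (f : A -> nat) (g : B -> nat) l l' :
  list_sum (map (fun pq => f (fst pq) + g (snd pq)) (list_prod l l')) =
  list_sum (map f l) * length l' + length l * list_sum (map g l').
Proof.
  induction l as [|a l IH]; simpl; auto.
  rewrite map_app, list_sum_app, IH, map_map; simpl.
  assert (X : list_sum (map (fun x => f a + g x) l') = f a * length l' + list_sum (map g l')).
  { clear; induction l' as [|b l' IH]; simpl; [|rewrite IH]; lia. }
  rewrite X; lia.
Qed.

Lemma schroder_r_succ n :
  schroder_r (S n) = schroder_r n + list_sum (map (fun i => schroder_r i * schroder_r (n - i)) (seq 0 (S n))).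
Proof.
  unfold schroder_r at 1; rewrite (Permutation_length (schroder_succ n)).
  rewrite length_app, length_map, length_flat_map; f_equal; f_equal.
  apply map_ext; intros i; rewrite length_map, length_prod; auto.
Qed.

Definition start_U_count n := list_sum (map start_U (schroder n)).

Lemma start_U_count_0 : start_U_count 0 = 0.
Proof. reflexivity. Qed.

(** The nonempty paths that do not begin with [U] are [H] followed by any path of semi-length
    [n]. *)
Lemma start_U_count_succ n : start_U_count (S n) + schroder_r n = schroder_r (S n).
Proof.
  unfold start_U_count.
  rewrite (list_sum_perm _ _ (Permutation_map start_U (schroder_succ n))).
  unfold schroder_r at 2; rewrite (Permutation_length (schroder_succ n)).
  rewrite map_app, list_sum_app, length_app, length_map, map_map.
  assert (X : forall l, list_sum (map (fun x => start_U (H :: x)) l) = 0) by (induction l; auto).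
  rewrite X, list_sum_flat_map, length_flat_map; unfold schroder_r.
  rewrite (map_ext _ (fun i => length (map join (list_prod (schroder i) (schroder (n - i)))))); [lia|].
  intros i; generalize (list_prod (schroder i) (schroder (n - i))) as l.
  induction l as [|[p q] l IH]; simpl; auto.
Qed.

(** The isolated [schroder_r n] counts the leading [H] steps; [start_U_count] counts the valleys
    created at the first return. *)
Lemma ell_succ n :
  ell (S n) = schroder_r n + ell n +
    list_sum (map (fun i => ell i * schroder_r (n - i)
                            + schroder_r i * (ell (n - i) + start_U_count (n - i))) (seq 0 (S n))).
Proof.
  rewrite ell_deg, (list_sum_perm _ _ (Permutation_map deg (schroder_succ n))).
  rewrite map_app, list_sum_app, map_map, list_sum_flat_map; f_equal.
  - rewrite ell_deg; unfold schroder_r; clear.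
    induction (schroder n) as [|p l IH]; simpl in *; lia.
  - f_equal; apply map_ext; intros i; rewrite map_map.
    rewrite (map_ext _ (fun pq => deg (fst pq) + (deg (snd pq) + start_U (snd pq)))).
    + rewrite (list_sum_list_prod deg (fun q => deg q + start_U q)), !ell_deg.
      unfold schroder_r, start_U_count; f_equal; f_equal.
      generalize (schroder (n - i)) as l; clear.
      induction l as [|p l IH]; simpl; lia.
    + intros [p q]; rewrite deg_join; simpl; lia.
Qed.

(** * Generating functions *)

Local Open Scope R_scope.

(** Convergence and value on a whole disc are kept together, so that algebra on sequences and on
    their sums proceeds in parallel without separate radius conditions. *)
Definition gf (rho : R) (a : nat -> R) (f : R -> R) :=
  forall x, Rabs x < rho -> is_pseries a x (f x).

Lemma gf_radius rho a f x : gf rho a f -> Rabs x < rho -> Rbar_lt (Rabs x) (CV_radius a).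
Proof.
  intros G Hx.
  (* Convergence at [x] would only bound the radius below by [Rabs x]; a point strictly between
     [Rabs x] and [rho] makes the inequality strict. *)
  pose (y := (Rabs x + rho) / 2).
  assert (Hy : Rabs x < Rabs y < rho).
  { pose proof (Rabs_pos x); unfold y; rewrite (Rabs_pos_eq (_ / 2)); lra. }
  apply Rbar_lt_le_trans with (Rabs y); [simpl; lra|].
  apply Rbar_not_lt_le; intros Hlt.
  apply (CV_disk_outside a y Hlt).
  apply ex_series_lim_0; exists (f y); apply is_pseries_R, G; lra.
Qed.

Lemma gf_ext rho a b f g :
  (forall n, a n = b n) -> (forall x, Rabs x < rho -> f x = g x) -> gf rho a f -> gf rho b g.
Proof. intros E F G x Hx; rewrite <- F by auto; apply (is_pseries_ext a); auto. Qed.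

Lemma gf_plus rho a b f g : gf rho a f -> gf rho b g ->
  gf rho (fun n => a n + b n) (fun x => f x + g x).
Proof. intros A B x Hx; exact (is_pseries_plus _ _ _ _ _ (A x Hx) (B x Hx)). Qed.

Lemma gf_scal rho c a f : gf rho a f -> gf rho (fun n => c * a n) (fun x => c * f x).
Proof.
  intros A x Hx; apply (is_pseries_scal c a x (f x)); auto; apply Rmult_comm.
Qed.

Lemma gf_minus rho a b f g : gf rho a f -> gf rho b g ->
  gf rho (fun n => a n - b n) (fun x => f x - g x).
Proof. intros A B x Hx; exact (is_pseries_minus _ _ _ _ _ (A x Hx) (B x Hx)). Qed.

Definition pshift (a : nat -> R) (n : nat) : R := match n with O => 0 | S m => a m end.

Lemma gf_shift rho a f : gf rho a f -> gf rho (pshift a) (fun x => x * f x).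
Proof. intros A x Hx; exact (is_pseries_incr_1 _ _ _ (A x Hx)). Qed.

Lemma gf_mult rho a b f g : gf rho a f -> gf rho b g ->
  gf rho (PS_mult a b) (fun x => f x * g x).
Proof.
  intros A B x Hx; apply is_pseries_mult; auto; eapply gf_radius; eauto.
Qed.

Definition one_seq (n : nat) : R := match n with O => 1 | S _ => 0 end.

Lemma gf_one_seq rho : gf rho one_seq (fun _ => 1).
Proof.
  intros x _; apply is_pseries_R, is_series_Reals.
  intros e He; exists O; intros n _.
  replace (sum_f_R0 _ n) with 1; [rewrite R_dist_eq; auto|].
  induction n as [|n IH]; simpl; [ring|rewrite <- IH; ring].
Qed.

Lemma gf_dilate rho c a f : gf rho a f -> 0 < c ->
  gf (rho / c) (fun n => a n * c ^ n) (fun x => f (c * x)).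
Proof.
  intros A Hc x Hx; apply is_pseries_R.
  apply is_series_ext with (fun n => a n * (c * x) ^ n).
  { intros n; rewrite Rpow_mult_distr; apply eq_sym, Rmult_assoc. }
  apply is_pseries_R, A; rewrite Rabs_mult, (Rabs_pos_eq c) by lra.
  apply Rmult_lt_compat_l with (r := c) in Hx; auto.
  replace (c * (rho / c)) with rho in Hx by (field; lra); auto.
Qed.

Lemma gf_restrict rho rho' a f : rho' <= rho -> gf rho a f -> gf rho' a f.
Proof. intros Hr A x Hx; apply A; lra. Qed.

Lemma gf_PSeries rho a f x : gf rho a f -> Rabs x < rho -> PSeries a x = f x.
Proof. intros A Hx; apply is_pseries_unique, A, Hx. Qed.

Lemma gf_0 rho a f : 0 < rho -> gf rho a f -> f 0 = a O.
Proof.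
  intros Hr A; rewrite <- (gf_PSeries _ _ _ 0 A), PSeries_0; auto; rewrite Rabs_R0; auto.
Qed.

Lemma gf_inj rho a b f g : 0 < rho -> gf rho a f -> gf rho b g ->
  (forall x, Rabs x < rho -> f x = g x) -> forall n, a n = b n.
Proof.
  intros Hr A B E n.
  assert (R0 : Rabs 0 < rho) by (rewrite Rabs_R0; auto).
  apply PSeries_ext_recip.
  - rewrite <- Rabs_R0; eapply gf_radius; eauto.
  - rewrite <- Rabs_R0; eapply gf_radius; eauto.
  - exists (mkposreal rho Hr); intros x Hx.
    assert (Rabs x < rho).
    { unfold ball in Hx; simpl in Hx; unfold AbsRing_ball, abs, minus, plus, opp in Hx;
        simpl in Hx; rewrite Ropp_0, Rplus_0_r in Hx; auto. }
    rewrite (gf_PSeries _ _ _ _ A), (gf_PSeries _ _ _ _ B); auto.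
Qed.

Lemma Rabs_lt_sub (rho x y : R) : Rabs (y - x) < rho - Rabs x -> Rabs y < rho.
Proof.
  intros Hy; pose proof (Rabs_triang x (y - x)) as T.
  replace (x + (y - x)) with y in T by ring; lra.
Qed.

Lemma locally_Rabs_lt rho x : Rabs x < rho -> locally x (fun y => Rabs y < rho).
Proof.
  intros Hx; assert (P : 0 < rho - Rabs x) by lra.
  exists (mkposreal _ P); intros y Hy; exact (Rabs_lt_sub rho x y Hy).
Qed.

Lemma gf_is_derive rho a f x : gf rho a f -> Rabs x < rho ->
  is_derive f x (PSeries (PS_derive a) x).
Proof.
  intros A Hx; apply is_derive_ext_loc with (PSeries a).
  - apply filter_imp with (2 := locally_Rabs_lt _ _ Hx); intros y Hy; eapply gf_PSeries; eauto.
  - apply is_derive_PSeries; eapply gf_radius; eauto.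
Qed.

Lemma gf_derive rho a f g : gf rho a f ->
  (forall x, Rabs x < rho -> is_derive f x (g x)) -> gf rho (PS_derive a) g.
Proof.
  intros A E x Hx.
  replace (g x) with (PSeries (PS_derive a) x).
  - apply PSeries_correct; eexists; apply is_pseries_derive; eapply gf_radius; eauto.
  - rewrite <- (is_derive_unique _ _ _ (gf_is_derive _ _ _ _ A Hx)).
    apply is_derive_unique; auto.
Qed.

Lemma ex_series_geom_scal M (q : R) : Rabs q < 1 -> ex_series (fun n => M * q ^ n).
Proof.
  intros Hq; exists (M * / (1 - q)).
  exact (is_series_scal M (fun n => q ^ n) _ (is_series_geom q Hq)).
Qed.

Lemma gf_of_bound a M K : 0 < K -> (forall n, Rabs (a n) <= M * K ^ n) ->
  gf (/ K) a (PSeries a).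
Proof.
  intros HK Ha x Hx; apply PSeries_correct, CV_disk_correct.
  apply (ex_series_le (fun n => Rabs (a n * x ^ n)) (fun n => M * (K * Rabs x) ^ n)).
  - intros n; unfold norm; simpl; unfold abs; simpl.
    rewrite Rabs_Rabsolu, Rabs_mult, <- RPow_abs, Rpow_mult_distr, <- Rmult_assoc.
    apply Rmult_le_compat_r; auto; apply pow_le, Rabs_pos.
  - apply ex_series_geom_scal.
    pose proof (Rabs_pos x).
    rewrite Rabs_mult, Rabs_Rabsolu, (Rabs_pos_eq K) by lra.
    apply Rmult_lt_compat_l with (r := K) in Hx; auto; rewrite Rinv_r in Hx; lra.
Qed.

Lemma PSeries_bound a M K x : 0 < K -> (forall n, Rabs (a n) <= M * K ^ n) ->
  K * Rabs x < 1 -> Rabs (PSeries a x) <= M / (1 - K * Rabs x).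
Proof.
  intros HK Ha Hx; pose proof (Rabs_pos x).
  assert (Q : Rabs (K * Rabs x) < 1)
    by (rewrite Rabs_mult, Rabs_Rabsolu, (Rabs_pos_eq K); lra).
  assert (E : forall n, 0 <= Rabs (a n * x ^ n) <= M * (K * Rabs x) ^ n).
  { intros n; split; [apply Rabs_pos|].
    rewrite Rabs_mult, <- RPow_abs, Rpow_mult_distr, <- Rmult_assoc.
    apply Rmult_le_compat_r; auto; apply pow_le; auto. }
  assert (X : ex_series (fun n => M * (K * Rabs x) ^ n))
    by (apply ex_series_geom_scal; auto).
  unfold PSeries; eapply Rle_trans; [apply Series_Rabs|eapply Rle_trans; [apply Series_le|]].
  - apply (ex_series_le (fun n => Rabs (a n * x ^ n)) (fun n => M * (K * Rabs x) ^ n)); auto.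
    intros n; unfold norm; simpl; unfold abs; simpl; rewrite Rabs_Rabsolu; apply E.
  - exact E.
  - exact X.
  - rewrite Series_scal_l, Series_geom; auto; apply Rle_refl.
Qed.

(** * Three-term recurrences and inverse square roots *)

(* The recurrence of the coefficients of [(1 - p x + q x^2) ^ (- 1 / 2)]. *)
Definition three_term (p q : R) (a : nat -> R) :=
  a O = 1 /\ forall n, INR (S n) * a (S n) = p * (INR n + / 2) * a n - q * INR n * a (pred n).

(** Divided by [n + 1], the coefficients of the recurrence are at most [Rabs p] and [Rabs q] in
    modulus; [K >= 1] lets the older term be bounded by the same power. *)
Lemma three_term_bound p q a : three_term p q a ->
  forall n, Rabs (a n) <= 1 * (Rabs p + Rabs q + 1) ^ n.
Proof.
  intros [a0 rec] n.
  set (K := Rabs p + Rabs q + 1).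
  assert (HK : 1 <= K) by (unfold K; pose proof (Rabs_pos p); pose proof (Rabs_pos q); lra).
  assert (X : Rabs (a n) <= K ^ n /\ Rabs (a (S n)) <= K ^ S n); [|lra].
  assert (Step : forall m, Rabs (a m) <= K ^ m -> Rabs (a (pred m)) <= K ^ m ->
                  Rabs (a (S m)) <= K ^ S m).
  { intros m H1 H2; pose proof (pos_INR m) as Hm.
    assert (HS : 0 < INR (S m)) by (rewrite S_INR; lra).
    apply Rmult_le_reg_l with (INR (S m)); auto.
    rewrite <- (Rabs_pos_eq (INR (S m))) at 1 by lra.
    rewrite <- Rabs_mult, rec, S_INR.
    unfold Rminus; eapply Rle_trans; [apply Rabs_triang|].
    rewrite Rabs_Ropp, !Rabs_mult, (Rabs_pos_eq (INR m)), (Rabs_pos_eq (INR m + / 2)) by lra.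
    pose proof (Rabs_pos p) as Pp; pose proof (Rabs_pos q) as Pq.
    pose proof (pow_lt K m ltac:(lra)) as PK.
    assert (A1 : Rabs p * (INR m + / 2) * Rabs (a m) <= Rabs p * (INR m + 1) * K ^ m).
    { apply Rmult_le_compat; auto; try apply Rabs_pos; nra. }
    assert (A2 : Rabs q * INR m * Rabs (a (pred m)) <= Rabs q * (INR m + 1) * K ^ m).
    { apply Rmult_le_compat; auto; try apply Rabs_pos; nra. }
    apply Rle_trans with ((Rabs p + Rabs q) * (INR m + 1) * K ^ m); [lra|].
    simpl; replace ((INR m + 1) * (K * K ^ m)) with (K * (INR m + 1) * K ^ m) by ring.
    apply Rmult_le_compat_r; [lra|]; apply Rmult_le_compat_r; [lra|]; unfold K; lra. }
  induction n as [|n [IH1 IH2]].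
  - assert (B0 : Rabs (a O) <= K ^ O) by (rewrite a0, Rabs_R1; simpl; lra).
    split; auto.
  - split; auto; apply Step; auto; simpl.
    pose proof (pow_lt K n ltac:(lra)); nra.
Qed.

(* The recurrence says [(1 - p x + q x^2) f' = (p / 2 - q x) f], so that
   [f * sqrt (1 - p x + q x^2)] is constant. *)
Lemma gf_inv_sqrt p q a rho f :
  three_term p q a -> 0 < rho ->
  (forall x, Rabs x < rho -> 0 < 1 - p * x + q * x ^ 2) ->
  gf rho a f ->
  forall x, Rabs x < rho -> f x = / sqrt (1 - p * x + q * x ^ 2).
Proof.
  intros [a0 rec] rho_pos disc_pos Hf x.
  set (f1 := PSeries (PS_derive a)).
  assert (Hf1 : gf rho (PS_derive a) f1)
    by (apply gf_derive with f; auto; intros; eapply gf_is_derive; eauto).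
  assert (ODE : forall y, Rabs y < rho -> (1 - p * y + q * y ^ 2) * f1 y = (p / 2 - q * y) * f y).
  { intros y Hy.
    pose proof (gf_plus _ _ _ _ _ (gf_minus _ _ _ _ _ Hf1 (gf_scal _ p _ _ (gf_shift _ _ _ Hf1)))
                  (gf_scal _ q _ _ (gf_shift _ _ _ (gf_shift _ _ _ Hf1)))) as G1.
    pose proof (gf_minus _ _ _ _ _ (gf_scal _ (p / 2) _ _ Hf) (gf_scal _ q _ _ (gf_shift _ _ _ Hf))) as G2.
    assert (E : f1 y - p * (y * f1 y) + q * (y * (y * f1 y)) = p / 2 * f y - q * (y * f y)); [|lra].
    rewrite <- (gf_PSeries _ _ _ y G1 Hy), <- (gf_PSeries _ _ _ y G2 Hy).
    apply PSeries_ext; intros [|n]; unfold PS_derive.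
    - rewrite rec; simpl; rewrite a0; match goal with |- ?u = ?v => change (@eq R u v) end; field.
    - rewrite rec; destruct n as [|n]; cbn [pshift pred]; rewrite !S_INR; change (INR 0) with 0;
        match goal with |- ?u = ?v => change (@eq R u v) end; field. }
  assert (Const : forall y, Rabs y < rho ->
            is_derive (fun t => f t * sqrt (1 - p * t + q * t ^ 2)) y 0).
  { intros y Hy; pose proof (disc_pos y Hy) as Dy.
    pose proof (gf_is_derive _ _ _ _ Hf Hy) as DF.
    auto_derive.
    - split; [eexists; exact DF|]; split; auto; simpl in *; lra.
    - replace (Derive (fun t => f t) y) with (f1 y) by (apply eq_sym, is_derive_unique; exact DF).
      replace (1 + - (p * y) + q * (y * (y * 1))) with (1 - p * y + q * y ^ 2) by ring.
      pose proof (sqrt_lt_R0 _ Dy) as Sy; pose proof (sqrt_sqrt _ (Rlt_le _ _ Dy)) as SS.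
      set (s := sqrt (1 - p * y + q * y ^ 2)) in *.
      pose proof (ODE y Hy) as O; rewrite <- SS in O.
      apply Rmult_eq_reg_l with s; [|lra]; rewrite Rmult_0_r.
      transitivity (s * s * f1 y + f y * (- p + q * 2 * y) / 2); [field; lra|].
      rewrite O; field. }
  assert (F0 : f 0 * sqrt (1 - p * 0 + q * 0 ^ 2) = 1).
  { rewrite (gf_0 _ _ _ rho_pos Hf), a0.
    replace (1 - p * 0 + q * 0 ^ 2) with 1 by ring; rewrite sqrt_1; ring. }
  intros Hx; assert (F : f x * sqrt (1 - p * x + q * x ^ 2) = 1).
  { apply eq_trans with (2 := F0); destruct (Rtotal_order x 0) as [Lx|[->|Lx]]; auto.
    - apply (eq_is_derive (fun t => f t * sqrt (1 - p * t + q * t ^ 2)) x 0); auto.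
      intros t Ht; apply Const; rewrite Rabs_left1 in *; lra.
    - apply eq_sym, (eq_is_derive (fun t => f t * sqrt (1 - p * t + q * t ^ 2)) 0 x); auto.
      intros t Ht; apply Const; rewrite Rabs_pos_eq in *; lra. }
  pose proof (sqrt_lt_R0 _ (disc_pos x Hx)).
  apply Rmult_eq_reg_r with (sqrt (1 - p * x + q * x ^ 2)); [|lra].
  rewrite F; field; lra.
Qed.

(** * Delannoy numbers *)

Lemma binom_0 n : binom n 0 = 1%nat.
Proof. destruct n; reflexivity. Qed.

Lemma binom_gt n k : (n < k)%nat -> binom n k = 0%nat.
Proof.
  revert k; induction n as [|n IH]; intros [|k] L; try lia; simpl; auto.
  rewrite !IH; lia.
Qed.

Lemma binom_fact k j : (binom (k + j) k * (fact k * fact j) = fact (k + j))%nat.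
Proof.
  remember (k + j)%nat as n eqn:E; revert k j E.
  induction n as [|n IH]; intros k j E.
  - destruct k, j; simpl in *; lia.
  - destruct k as [|k]; [simpl in E; subst j; rewrite binom_0; change (fact 0) with 1%nat; ring|].
    destruct j as [|j].
    + replace n with k in * by lia; simpl binom; rewrite (binom_gt k (S k)) by lia.
      pose proof (IH k 0%nat ltac:(lia)) as I; change (fact 0) with 1%nat in *.
      change (fact (S k)) with (S k * fact k)%nat; rewrite Nat.mul_1_r in *.
      rewrite Nat.add_0_r; rewrite <- I at 2; ring.
    + simpl binom.
      pose proof (IH k (S j) ltac:(lia)) as I1; pose proof (IH (S k) j ltac:(lia)) as I2.
      change (fact (S n)) with (S n * fact n)%nat; change (fact (S k)) with (S k * fact k)%nat in *.
      change (fact (S j)) with (S j * fact j)%nat in *.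
      replace (S n * fact n)%nat with (S k * fact n + S j * fact n)%nat by (rewrite E; ring).
      rewrite <- I1 at 1; rewrite <- I2; ring.
Qed.

Definition dterm (n k : nat) : R := INR (binom n k * binom (n + k) k).

Lemma dterm_gt n k : (n < k)%nat -> dterm n k = 0.
Proof. intros L; unfold dterm; rewrite binom_gt by auto; reflexivity. Qed.

Lemma dterm_0 n : dterm n 0 = 1.
Proof. unfold dterm; rewrite !binom_0; reflexivity. Qed.

(** With [n = k + j] the product of binomials is the multinomial (2k+j)!/(k! k! j!), so neighbouring
    terms have rational ratios. *)
Lemma dterm_fact k j :
  dterm (k + j) k = INR (fact (2 * k + j)) / (INR (fact k) ^ 2 * INR (fact j)).
Proof.
  unfold dterm; rewrite mult_INR.
  pose proof (binom_fact k j) as E1; pose proof (binom_fact k (k + j)) as E2.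
  apply (f_equal INR) in E1, E2; rewrite !mult_INR in E1, E2.
  replace (k + j + k)%nat with (k + (k + j))%nat by lia.
  replace (2 * k + j)%nat with (k + (k + j))%nat by lia.
  rewrite <- E2, <- E1.
  pose proof (INR_fact_neq_0 k); pose proof (INR_fact_neq_0 j); field; auto.
Qed.

Lemma INR_fact_S n : INR (fact (S n)) = (INR n + 1) * INR (fact n).
Proof. change (fact (S n)) with (S n * fact n)%nat; rewrite mult_INR, S_INR; auto. Qed.

Lemma dterm_pred n k : (k <= S n)%nat ->
  dterm n k = dterm (S n) k * (INR (S n) - INR k) / (INR (S n) + INR k).
Proof.
  intros L; pose proof (pos_INR n); pose proof (pos_INR k).
  destruct (Nat.eq_dec k (S n)) as [->|N].
  - rewrite dterm_gt by lia; rewrite S_INR; field; lra.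
  - replace n with (k + (n - k))%nat by lia; generalize (n - k)%nat; clear; intros j.
    replace (S (k + j)) with (k + S j)%nat by lia; rewrite !dterm_fact.
    replace (2 * k + S j)%nat with (S (2 * k + j)) by lia.
    rewrite !INR_fact_S, !plus_INR, S_INR, mult_INR; simpl (INR 2).
    pose proof (pos_INR k); pose proof (pos_INR j).
    pose proof (INR_fact_neq_0 k); pose proof (INR_fact_neq_0 j); field; repeat split; auto; lra.
Qed.

Lemma dterm_succ_r n k : (k <= n)%nat ->
  dterm n (S k) = dterm n k * (INR n + INR k + 1) * (INR n - INR k) / (INR k + 1) ^ 2.
Proof.
  intros L; pose proof (pos_INR k).
  destruct (Nat.eq_dec k n) as [->|N].
  - rewrite dterm_gt by lia; field; lra.
  - replace n with (S k + (n - S k))%nat by lia; generalize (n - S k)%nat; clear; intros j.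
    rewrite dterm_fact; replace (S k + j)%nat with (k + S j)%nat by lia; rewrite dterm_fact.
    replace (2 * S k + j)%nat with (S (2 * k + S j)) by lia.
    rewrite !INR_fact_S, !plus_INR, S_INR, mult_INR; simpl (INR 2).
    pose proof (pos_INR k); pose proof (pos_INR j).
    pose proof (INR_fact_neq_0 k); pose proof (INR_fact_neq_0 j); field; repeat split; auto; lra.
Qed.

Lemma INR_list_sum_seq f n :
  INR (list_sum (map f (seq 0 (S n)))) = sum_f_R0 (fun i => INR (f i)) n.
Proof.
  induction n as [|n IH]; [simpl; rewrite Nat.add_0_r; auto|].
  rewrite seq_S, map_app, list_sum_app, plus_INR, IH; simpl; rewrite Nat.add_0_r; auto.
Qed.

Definition dR (n : nat) : R := INR (delannoy n).

Lemma sum_dterm_ge n m : (n <= m)%nat -> sum_f_R0 (dterm n) m = dR n.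
Proof.
  induction 1 as [|m L IH].
  - unfold dR, delannoy; symmetry; exact (INR_list_sum_seq (fun k => binom n k * binom (n + k) k)%nat n).
  - simpl; rewrite IH, dterm_gt by lia; ring.
Qed.

(* The two closed forms below come from Zeilberger's algorithm. *)
Lemma dterm_telescope_delannoy n m : (m <= S (S n))%nat ->
  sum_f_R0 (fun k => INR (S (S n)) * dterm (S (S n)) k - (6 * INR (S n) + 3) * dterm (S n) k
                     + INR (S n) * dterm n k) m =
  - (4 * INR n + 6) * (INR (S (S n)) - INR m) * dterm (S (S n)) m / (INR (S (S n)) + INR m).
Proof.
  intros L; pose proof (pos_INR n) as Pn.
  (* Extends [dterm_pred] by the index [k = n + 2], where both terms vanish. *)
  assert (E : forall k, (k <= S (S n))%nat -> dterm n k =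
            dterm (S n) k * (INR (S n) - INR k) / (INR (S n) + INR k)).
  { intros k Lk; destruct (Nat.eq_dec k (S (S n))) as [->|].
    - rewrite !dterm_gt by lia; unfold Rdiv; ring.
    - apply dterm_pred; lia. }
  induction m as [|m IH].
  - cbn [sum_f_R0]; rewrite !dterm_0, !S_INR; change (INR 0) with 0; field; lra.
  - pose proof (pos_INR m) as Pm.
    rewrite tech5, IH, (E (S m)), (dterm_pred (S n)), dterm_succ_r by lia.
    rewrite !S_INR; field; lra.
Qed.

Lemma dterm_telescope_schroder n m : (m <= S n)%nat ->
  sum_f_R0 (fun k => 2 * (INR (S n) + 1) * (dterm (S n) k / (INR k + 1)) - 3 * dterm (S n) k
                     + dterm n k) m =
  2 * (INR (S n) - INR m) * dterm (S n) m / (INR m + 1).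
Proof.
  intros L; pose proof (pos_INR n) as Pn.
  induction m as [|m IH].
  - cbn [sum_f_R0]; rewrite !dterm_0, !S_INR; change (INR 0) with 0; field; lra.
  - pose proof (pos_INR m) as Pm.
    rewrite tech5, IH, (dterm_pred n), dterm_succ_r by lia.
    rewrite !S_INR; field; lra.
Qed.

Lemma sum_lin3 (f g h : nat -> R) a b c m :
  sum_f_R0 (fun k => a * f k - b * g k + c * h k) m =
  a * sum_f_R0 f m - b * sum_f_R0 g m + c * sum_f_R0 h m.
Proof. induction m as [|m IH]; simpl; [|rewrite IH]; ring. Qed.

(** At [m = n + 2] the closed form of the telescoped sum contains the factor 0, and what remains is
    the recurrence. *)
Lemma delannoy_three_term : three_term 6 1 dR.
Proof.
  split; [unfold dR; simpl; lra|].
  intros [|n]; [unfold dR; simpl; lra|].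
  pose proof (dterm_telescope_delannoy n (S (S n)) (Nat.le_refl _)) as E.
  rewrite sum_lin3, !sum_dterm_ge in E by lia.
  simpl pred; rewrite !S_INR in *; unfold Rdiv in E; ring_simplify in E.
  lra.
Qed.

(** Since C(n,k) C(n+k,k) = C(n+k,2k) C(2k,k), this is the sum of C(n+k,2k) times the Catalan number
    of index [k], a classical expression for the large Schröder numbers. *)
Definition cat_sum (n : nat) : R := sum_f_R0 (fun k => dterm n k / (INR k + 1)) n.

Lemma cat_sum_delannoy n : 2 * (INR (S n) + 1) * cat_sum (S n) = 3 * dR (S n) - dR n.
Proof.
  pose proof (dterm_telescope_schroder n (S n) (Nat.le_refl _)) as E.
  rewrite (sum_eq _ (fun k => 2 * (INR (S n) + 1) * (dterm (S n) k / (INR k + 1)) - 3 * dterm (S n) k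
                     + 1 * dterm n k)) in E by (intros; ring).
  rewrite sum_lin3, !sum_dterm_ge in E by lia.
  unfold cat_sum; replace (INR (S n) - INR (S n)) with 0 in E by ring.
  unfold Rdiv in E at 2; ring_simplify in E; ring_simplify; lra.
Qed.

(** * Generating functions of Schröder paths *)

Definition rR (n : nat) : R := INR (schroder_r n).
Definition eR (n : nat) : R := INR (ell n).
(* From [r_n <= 3 * 9 ^ n] and [ell n <= r_n ^ 2]. *)
Definition rho0 : R := / 81.
Definition rf : R -> R := PSeries rR.
Definition ef : R -> R := PSeries eR.
(** The factor [1 *] keeps the literal shape of [gf_inv_sqrt] at [p = 6], [q = 1]. *)
Definition sq (x : R) : R := sqrt (1 - 6 * x + 1 * x ^ 2).

Lemma rR_bound n : Rabs (rR n) <= 3 * 9 ^ n.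
Proof.
  unfold rR; rewrite Rabs_pos_eq by apply pos_INR.
  eapply Rle_trans; [apply le_INR, schroder_r_le|].
  rewrite mult_INR, pow_INR; simpl; apply Req_le; f_equal; [ring|f_equal; ring].
Qed.

Lemma gf_r : gf rho0 rR rf.
Proof.
  apply gf_restrict with (/ 9); [unfold rho0; lra|].
  apply gf_of_bound with 3; [lra|apply rR_bound].
Qed.

Lemma gf_e : gf rho0 eR ef.
Proof.
  apply gf_of_bound with 9; [lra|].
  intros n; unfold eR; rewrite Rabs_pos_eq by apply pos_INR.
  eapply Rle_trans; [apply le_INR, ell_le|].
  rewrite mult_INR; pose proof (rR_bound n) as B; unfold rR in B.
  rewrite Rabs_pos_eq in B by apply pos_INR.
  replace (9 * 81 ^ n) with ((3 * 9 ^ n) * (3 * 9 ^ n)).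
  - apply Rmult_le_compat; auto; apply pos_INR.
  - replace 81 with (9 * 9) by ring; rewrite Rpow_mult_distr; ring.
Qed.

Lemma PS_mult_INR (f g : nat -> nat) n :
  INR (list_sum (map (fun i => f i * g (n - i))%nat (seq 0 (S n)))) =
  PS_mult (fun i => INR (f i)) (fun i => INR (g i)) n.
Proof.
  rewrite INR_list_sum_seq; apply sum_eq; intros i _; apply mult_INR.
Qed.

Lemma rf_eq x : Rabs x < rho0 -> rf x = 1 + x * (rf x + rf x * rf x).
Proof.
  intros Hx.
  pose proof (gf_plus _ _ _ _ _ (gf_one_seq rho0)
    (gf_shift _ _ _ (gf_plus _ _ _ _ _ gf_r (gf_mult _ _ _ _ _ gf_r gf_r)))) as G.
  rewrite <- (gf_PSeries _ _ _ x G Hx), <- (gf_PSeries _ _ _ x gf_r Hx) at 1.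
  apply PSeries_ext; intros [|n]; simpl one_seq; simpl pshift.
  - unfold rR; simpl; lra.
  - unfold rR at 1; rewrite schroder_r_succ, plus_INR, (PS_mult_INR schroder_r schroder_r).
    rewrite Rplus_0_l; reflexivity.
Qed.

(** The coefficients of [R - 1 - x R]: removing the empty path and the paths beginning with [H]
    leaves those beginning with [U]. *)
Definition uR (n : nat) : R := rR n - one_seq n - pshift rR n.

Lemma uR_start_U n : uR n = INR (start_U_count n).
Proof.
  destruct n as [|n]; unfold uR; simpl one_seq; simpl pshift.
  - rewrite start_U_count_0; unfold rR; simpl; lra.
  - unfold rR; rewrite <- start_U_count_succ, plus_INR; lra.
Qed.

Lemma gf_u : gf rho0 uR (fun x => rf x - 1 - x * rf x).
Proof. apply gf_minus; [apply gf_minus; [apply gf_r|apply gf_one_seq]|apply gf_shift, gf_r]. Qed.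

Lemma ef_eq x : Rabs x < rho0 ->
  ef x = x * (rf x + ef x + (ef x * rf x + rf x * (ef x + (rf x - 1 - x * rf x)))).
Proof.
  intros Hx.
  pose proof (gf_shift _ _ _ (gf_plus _ _ _ _ _ (gf_plus _ _ _ _ _ gf_r gf_e)
    (gf_plus _ _ _ _ _ (gf_mult _ _ _ _ _ gf_e gf_r)
       (gf_mult _ _ _ _ _ gf_r (gf_plus _ _ _ _ _ gf_e gf_u))))) as G.
  rewrite <- (gf_PSeries _ _ _ x G Hx), <- (gf_PSeries _ _ _ x gf_e Hx) at 1.
  apply PSeries_ext; intros [|n]; simpl pshift.
  - unfold eR; reflexivity.
  - unfold eR at 1; rewrite ell_succ, !plus_INR, INR_list_sum_seq.
    f_equal; unfold PS_mult; rewrite <- sum_plus; apply sum_eq; intros i _.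
    rewrite uR_start_U; unfold eR, rR; rewrite plus_INR, !mult_INR, plus_INR; auto.
Qed.

Lemma disc_pos x : Rabs x < rho0 -> 0 < 1 - 6 * x + 1 * x ^ 2.
Proof. intros Hx; unfold rho0 in Hx; apply Rabs_def2 in Hx; nra. Qed.

Lemma sq_pos x : Rabs x < rho0 -> 0 < sq x.
Proof. intros Hx; apply sqrt_lt_R0, disc_pos, Hx. Qed.

Lemma sq_rf x : Rabs x < rho0 -> sq x = 1 - x - 2 * x * rf x.
Proof.
  intros Hx; unfold sq; apply sqrt_lem_1.
  - pose proof (disc_pos x Hx); lra.
  - unfold rho0 in Hx.
    (* On this disc 3 / (1 - 9 |x|) is below 27/8, so [x * rf x] is small enough for the right-hand
       side to be positive, which selects the root. *)
    assert (B : Rabs (rf x) <= 4).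
    { eapply Rle_trans; [apply (PSeries_bound rR 3 9 x); [lra|apply rR_bound|lra]|].
      apply Rmult_le_reg_r with (1 - 9 * Rabs x); [lra|].
      unfold Rdiv; rewrite Rmult_assoc, Rinv_l; lra. }
    assert (A : Rabs (x * rf x) <= / 81 * 4).
    { rewrite Rabs_mult; apply Rmult_le_compat; auto using Rabs_pos; lra. }
    apply Rabs_le_between in A; apply Rabs_def2 in Hx; lra.
  - pose proof (rf_eq x Hx) as E.
    replace ((1 - x - 2 * x * rf x) * (1 - x - 2 * x * rf x)) with
      ((1 - x) ^ 2 - 4 * x * (rf x - (x * (rf x + rf x * rf x)))) by ring.
    replace (rf x - x * (rf x + rf x * rf x)) with 1 by lra; ring.
Qed.

Lemma gf_d : gf rho0 dR (fun x => / sq x).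
Proof.
  assert (G : gf rho0 dR (PSeries dR)).
  { apply gf_restrict with (/ (Rabs 6 + Rabs 1 + 1)).
    - unfold rho0; rewrite !Rabs_pos_eq by lra; lra.
    - apply gf_of_bound with 1; [rewrite !Rabs_pos_eq by lra; lra|].
      apply three_term_bound, delannoy_three_term. }
  apply gf_ext with (3 := G); auto; intros x Hx.
  apply (gf_inv_sqrt 6 1 dR rho0); auto using delannoy_three_term, disc_pos; unfold rho0; lra.
Qed.

(** Multiplied by [sq x], both sides become [(1 - x) x R^2], by means of [x R^2 = R - 1 - x R]. *)
Lemma ef_closed x : Rabs x < rho0 -> ef x = (/ sq x - rf x) - x * (/ sq x - rf x).
Proof.
  intros Hx; pose proof (rf_eq x Hx) as E1; pose proof (ef_eq x Hx) as E2.
  pose proof (sq_pos x Hx) as P; pose proof (sq_rf x Hx) as E3.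
  apply Rmult_eq_reg_r with (sq x); [|lra].
  transitivity ((1 - x) * (1 - rf x * sq x)); [|field; lra].
  rewrite E3 at 1; rewrite E3.
  assert (E4 : ef x * (1 - x - 2 * x * rf x) = x * rf x * (1 + (rf x - 1 - x * rf x))) by lra.
  rewrite E4.
  replace (1 - rf x * (1 - x - 2 * x * rf x)) with
    (1 - rf x + x * rf x + 2 * (x * rf x * rf x)) by ring.
  assert (E5 : x * rf x * rf x = rf x - 1 - x * rf x) by lra.
  replace (1 - rf x + x * rf x + 2 * (x * rf x * rf x)) with (x * rf x * rf x) by lra.
  ring.
Qed.

Lemma edge_gf_ef x : x <> 0 -> Rabs x < rho0 -> edge_gf x = ef x.
Proof.
  intros Nx Hx; pose proof (sq_pos x Hx) as P; pose proof (sq_rf x Hx) as E3.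
  rewrite ef_closed by auto; unfold edge_gf.
  replace (1 - 6 * x + x ^ 2) with (1 - 6 * x + 1 * x ^ 2) by ring; fold (sq x).
  assert (E : rf x = (1 - x - sq x) / (2 * x)) by (rewrite E3; field; auto).
  pose proof (sqrt_sqrt _ (Rlt_le _ _ (disc_pos x Hx))) as SS; fold (sq x) in SS.
  rewrite E.
  (* The numerator is rewritten through the discriminant, so that everything is rational in [x] and
     [sq x]. *)
  replace (1 - 4 * x + x ^ 2) with (1 - 6 * x + 1 * x ^ 2 + 2 * x) by ring; rewrite <- SS.
  field; lra.
Qed.

Lemma ell_delannoy n : eR n = (dR n - rR n) - pshift (fun k => dR k - rR k) n.
Proof.
  pose proof (gf_minus _ _ _ _ _ gf_d gf_r) as G.
  refine (gf_inj rho0 _ _ _ _ _ gf_e (gf_minus _ _ _ _ _ G (gf_shift _ _ _ G)) _ n).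
  - unfold rho0; lra.
  - exact ef_closed.
Qed.

(* Comparing coefficients in [(sqrt (1 - 6 x + x^2))' = (x - 3) / sqrt (1 - 6 x + x^2)]. *)
Lemma schroder_delannoy n : 2 * (INR (S n) + 1) * rR (S n) = 3 * dR (S n) - dR n.
Proof.
  assert (G : gf rho0 (fun n => one_seq n - pshift one_seq n - 2 * pshift rR n) sq).
  { apply gf_ext with (3 := gf_minus _ _ _ _ _ (gf_minus _ _ _ _ _ (gf_one_seq rho0)
      (gf_shift _ _ _ (gf_one_seq rho0))) (gf_scal _ 2 _ _ (gf_shift _ _ _ gf_r))); auto.
    intros x Hx; rewrite sq_rf by auto; ring. }
  assert (G' : gf rho0 (PS_derive (fun n => one_seq n - pshift one_seq n - 2 * pshift rR n))
                 (fun x => x * / sq x - 3 * / sq x)).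
  { apply gf_derive with (1 := G); intros x Hx; pose proof (disc_pos x Hx) as Dx.
    pose proof (sq_pos x Hx) as P.
    unfold sq; auto_derive; [simpl in *; lra|].
    replace (1 + - (6 * x) + 1 * (x * (x * 1))) with (1 - 6 * x + 1 * x ^ 2) by ring.
    fold (sq x); field; lra. }
  assert (P : 0 < rho0) by (unfold rho0; lra).
  pose proof (gf_inj rho0 _ _ _ _ P G'
    (gf_minus _ _ _ _ _ (gf_shift _ _ _ gf_d) (gf_scal _ 3 _ _ gf_d))
    (fun x _ => eq_refl) (S n)) as E.
  unfold PS_derive in E; simpl one_seq in E; simpl pshift in E; rewrite !S_INR in *; lra.
Qed.

(** Both sequences satisfy the same relation expressing them through Delannoy numbers, one from the
    derivative of the square root, the other from telescoping. *)
Lemma rR_cat_sum n : rR n = cat_sum n.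
Proof.
  destruct n as [|n].
  - unfold rR, cat_sum, dterm; simpl; lra.
  - pose proof (schroder_delannoy n) as E; rewrite <- cat_sum_delannoy in E.
    pose proof (pos_INR (S n)); apply Rmult_eq_reg_l in E; auto; nra.
Qed.

Lemma rising_fact m j : rising (INR (S m)) j * INR (fact m) = INR (fact (m + j)).
Proof.
  induction j as [|j IH]; [rewrite Nat.add_0_r; simpl; ring|].
  cbn [rising]; rewrite Nat.add_succ_r, INR_fact_S, <- IH, plus_INR, !S_INR; ring.
Qed.

(** By [dterm_pred] the difference of the two terms is [dterm (S n) k] times 2k/(n+1+k); in
    factorials this is the multiset coefficient times C(2k,k). *)
Lemma multichoose_dterm n k : (k <= S n)%nat ->
  multichoose (2 * k) (S n - k) * Binomial.C (2 * k) k * (INR k / INR (k + 1)) =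
  dterm (S n) k * (INR k / (INR k + 1)) - dterm n k * (INR k / (INR k + 1)).
Proof.
  intros L; rewrite (dterm_pred n) by auto.
  replace (k + 1)%nat with (S k) by lia; rewrite S_INR.
  (* [rising_fact] needs a positive base [2 k]; at [k = 0] both sides carry the factor [k]. *)
  destruct k as [|k]; [simpl; unfold Rdiv; ring|].
  replace (S n) with (S k + (n - k))%nat by lia; generalize (n - k)%nat; clear; intros j.
  replace (S k + j - S k)%nat with j by lia.
  rewrite dterm_fact; unfold multichoose, Binomial.C.
  replace (2 * S k - S k)%nat with (S k) by lia.
  replace (2 * S k)%nat with (S (2 * k + 1)) by lia.
  replace (S (2 * k + 1) + j)%nat with (S (2 * k + 1 + j)) by lia.
  pose proof (rising_fact (2 * k + 1) j) as E.
  rewrite (INR_fact_S (2 * k + 1)), (INR_fact_S (2 * k + 1 + j)), <- E.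
  rewrite !plus_INR, !S_INR, plus_INR, mult_INR; change (INR 0) with 0; simpl (INR 2).
  pose proof (pos_INR k); pose proof (pos_INR j).
  pose proof (INR_fact_neq_0 (S k)); pose proof (INR_fact_neq_0 j).
  field; repeat split; auto; lra.
Qed.

Lemma ell_sum n : INR (ell n) =
  sum_f_R0 (fun k => multichoose (2 * k) (n - k) * Binomial.C (2 * k) k
                     * (INR k / INR (k + 1))) n.
Proof.
  (* Here k/(k+1) = 1 - 1/(k+1). The free upper limit [m] lets the sums for [n] and [n + 1] share
     one range. *)
  assert (X : forall n m, (n <= m)%nat ->
            sum_f_R0 (fun k => dterm n k * (INR k / (INR k + 1))) m = dR n - rR n).
  { clear n; intros n m L; rewrite rR_cat_sum; unfold cat_sum.
    rewrite <- (sum_dterm_ge n m L).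
    assert (E : sum_f_R0 (fun k => dterm n k / (INR k + 1)) n =
                sum_f_R0 (fun k => dterm n k / (INR k + 1)) m).
    { induction L as [|m L IH]; auto; simpl; rewrite <- IH, dterm_gt by lia; unfold Rdiv; ring. }
    rewrite E, <- minus_sum; apply sum_eq; intros k _; pose proof (pos_INR k); field; lra. }
  destruct n as [|n].
  - simpl; unfold Rdiv; ring.
  - rewrite (sum_eq _ (fun k => dterm (S n) k * (INR k / (INR k + 1))
                               - dterm n k * (INR k / (INR k + 1)))).
    + rewrite minus_sum, !X by lia; exact (ell_delannoy (S n)).
    + intros k L; apply multichoose_dterm; auto.
Qed.

(** * Wallis's estimate *)

(* [cb n = C(2n, n) / 4 ^ n]. *)
Fixpoint cb (n : nat) : R :=
  match n with O => 1 | S m => cb m * ((INR m + / 2) / (INR m + 1)) end.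

Lemma cb_pos n : 0 < cb n.
Proof.
  induction n as [|n IH]; simpl; [lra|]; pose proof (pos_INR n).
  apply Rmult_lt_0_compat; auto; apply Rdiv_lt_0_compat; lra.
Qed.

Lemma cb_three_term : three_term 1 0 cb.
Proof.
  split; [reflexivity|]; intros n; cbn [cb]; rewrite S_INR; pose proof (pos_INR n); field; lra.
Qed.

Definition wallis (n : nat) : R := RInt (fun t => sin t ^ n) 0 (PI / 2).

Lemma ex_RInt_sin_pow n : ex_RInt (fun t => sin t ^ n) 0 (PI / 2).
Proof.
  apply (ex_RInt_continuous (V := R_CompleteNormedModule)); intros z _; apply (ex_derive_continuous (fun t => sin t ^ n)).
  auto_derive; auto.
Qed.

(** The difference of the integrands has the antiderivative -cos t sin^(n+1) t, which vanishes at
    both endpoints. *)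
Lemma wallis_succ n : INR (S (S n)) * wallis (S (S n)) = INR (S n) * wallis n.
Proof.
  pose proof PI_RGT_0 as HPI.
  assert (I : is_RInt (fun t => INR (S (S n)) * sin t ^ (S (S n)) - INR (S n) * sin t ^ n) 0 (PI / 2)
    (- cos (PI / 2) * sin (PI / 2) ^ S n - - cos 0 * sin 0 ^ S n)).
  { apply (is_RInt_derive (fun t => - cos t * sin t ^ S n)).
    - intros x _; auto_derive; auto.
      pose proof (sin2_cos2 x) as E; unfold Rsqr in E.
      
      replace (match n with O => 1 | S _ => INR n + 1 end) with (INR n + 1) by (destruct n; [simpl; ring|reflexivity]).
      rewrite !S_INR; simpl pow.
      transitivity (sin x ^ n * (sin x * sin x) - (INR n + 1) * sin x ^ n * (cos x * cos x)); [ring|].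
      replace (cos x * cos x) with (1 - sin x * sin x) by lra; ring.
    - intros x _; apply (ex_derive_continuous (fun t => INR (S (S n)) * sin t ^ (S (S n)) - INR (S n) * sin t ^ n)).
      auto_derive; auto. }
  rewrite cos_PI2, sin_0 in I.
  replace (- 0 * sin (PI / 2) ^ S n - - cos 0 * 0 ^ S n) with 0 in I by (simpl; ring).
  pose proof (is_RInt_minus _ _ _ _ _ _
    (is_RInt_scal _ _ _ (INR (S (S n))) _ (RInt_correct _ _ _ (ex_RInt_sin_pow (S (S n)))))
    (is_RInt_scal _ _ _ (INR (S n)) _ (RInt_correct _ _ _ (ex_RInt_sin_pow n)))) as J.
  apply (is_RInt_unique (V := R_CompleteNormedModule)) in I; apply (is_RInt_unique (V := R_CompleteNormedModule)) in J.
  apply Rminus_diag_uniq; rewrite <- I; symmetry; exact J.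
Qed.

Lemma wallis_decr n : wallis (S n) <= wallis n.
Proof.
  pose proof PI_RGT_0 as HPI; apply RInt_le; [lra|apply ex_RInt_sin_pow|apply ex_RInt_sin_pow|].
  intros x Hx; assert (0 <= sin x) by (apply sin_ge_0; lra); pose proof (SIN_bound x) as B.
  pose proof (pow_le (sin x) n H); simpl; nra.
Qed.

Lemma wallis_even n : wallis (2 * n) = cb n * (PI / 2).
Proof.
  induction n as [|n IH].
  - unfold wallis; simpl; rewrite RInt_const; unfold scal; simpl; unfold mult; simpl; ring.
  - replace (2 * S n)%nat with (S (S (2 * n))) by lia.
    pose proof (wallis_succ (2 * n)) as E; rewrite IH, !S_INR, mult_INR in E.
    pose proof (pos_INR n); simpl (INR 2) in E; cbn [cb].
    apply Rmult_eq_reg_l with (2 * INR n + 1 + 1); [|lra].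
    transitivity (((1 + 1) * INR n + 1) * (cb n * (PI / 2))); [rewrite <- E; ring|field; lra].
Qed.

Lemma wallis_odd n : wallis (S (2 * n)) * ((2 * INR n + 1) * cb n) = 1.
Proof.
  induction n as [|n IH].
  - unfold wallis; simpl.
    assert (I : is_RInt (fun t => sin t * 1) 0 (PI / 2) (- cos (PI / 2) - - cos 0)).
    { apply (is_RInt_derive (fun t => - cos t)).
      - intros x _; auto_derive; auto; ring.
      - intros x _; apply (ex_derive_continuous (fun t => sin t * 1)); auto_derive; auto. }
    apply (is_RInt_unique (V := R_CompleteNormedModule)) in I; rewrite cos_PI2, cos_0 in I.
    match goal with |- ?X * _ = _ => replace X with (- 0 - - (1)) by (symmetry; exact I) end; ring.
  - replace (S (2 * S n)) with (S (S (S (2 * n)))) by lia.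
    pose proof (wallis_succ (S (2 * n))) as E; rewrite !S_INR, mult_INR in E.
    pose proof (pos_INR n); simpl (INR 2) in E; rewrite S_INR; cbn [cb].
    apply eq_trans with (2 := IH).
    transitivity ((((1 + 1) * INR n + 1 + 1 + 1) * wallis (S (S (S (2 * n))))) *
                  (cb n * ((2 * INR n + 1) / (2 * INR n + 2)))); [field; lra|].
    rewrite E; field; lra.
Qed.

(** The lower bound is W(2n+1) <= W(2n), the upper one W(2n) <= W(2n-1), where W is [wallis]. *)
Lemma cb_wallis n : 1 - / (2 * INR n + 1) <= cb n ^ 2 * (INR n * PI) <= 1.
Proof.
  pose proof PI_RGT_0 as HPI; pose proof (pos_INR n) as Pn; pose proof (cb_pos n) as Pc; split.
  - pose proof (wallis_decr (2 * n)) as D; rewrite wallis_even in D.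
    pose proof (wallis_odd n) as O.
    assert (P : 0 < (2 * INR n + 1) * cb n) by nra.
    apply Rmult_le_compat_r with (r := (2 * INR n + 1) * cb n) in D; [|lra].
    rewrite O in D.
    apply Rmult_le_reg_r with (2 * INR n + 1); [lra|].
    rewrite Rmult_minus_distr_r, Rinv_l by lra; nra.
  - destruct n as [|n]; [simpl; lra|].
    pose proof (wallis_decr (S (2 * n))) as D.
    replace (S (S (2 * n))) with (2 * S n)%nat in D by lia; rewrite wallis_even in D.
    pose proof (wallis_odd n) as O; pose proof (cb_pos n) as Pc'; pose proof (pos_INR n) as Pn'.
    assert (E : (2 * INR n + 1) * cb n = 2 * (INR n + 1) * cb (S n)) by (cbn [cb]; field; lra).
    rewrite E in O; rewrite S_INR in *.
    assert (P : 0 < 2 * (INR n + 1) * cb (S n)) by nra.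
    apply Rmult_le_compat_r with (r := 2 * (INR n + 1) * cb (S n)) in D; [|lra].
    rewrite O in D; nra.
Qed.

Lemma lim_inv_INR : is_lim_seq (fun n => / INR n) 0.
Proof. apply (is_lim_seq_inv INR p_infty); [apply is_lim_seq_INR|discriminate]. Qed.

Lemma lim_inv_lin c d : 0 < c -> 0 <= d -> is_lim_seq (fun n => / (c * INR n + d)) 0.
Proof.
  intros Hc Hd; apply (is_lim_seq_inv (fun n => c * INR n + d) p_infty); [|discriminate].
  apply is_lim_seq_le_p_loc with (fun n => c * INR n).
  - exists 0%nat; intros; lra.
  - apply is_lim_seq_ext with (fun n => INR n * c); [intros; ring|].
    apply (is_lim_seq_mult _ _ p_infty c p_infty); [apply is_lim_seq_INR|apply is_lim_seq_const|].
    unfold is_Rbar_mult; simpl; destruct (Rle_dec 0 c) as [Hle|]; [|lra].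
    destruct (Rle_lt_or_eq_dec 0 c Hle); [reflexivity|lra].
Qed.

Lemma lim_cb : is_lim_seq (fun n => cb n * sqrt (INR n * PI)) 1.
Proof.
  pose proof PI_RGT_0 as HPI.
  apply is_lim_seq_ext with (fun n => sqrt (cb n ^ 2 * (INR n * PI))).
  { intros n; pose proof (cb_pos n); pose proof (pos_INR n).
    rewrite sqrt_mult, sqrt_pow2; auto; try lra; nra. }
  rewrite <- sqrt_1; apply (is_lim_seq_continuous sqrt).
  - apply continuity_pt_sqrt; lra.
  - apply is_lim_seq_le_le with (fun n => 1 - / (2 * INR n + 1)) (fun _ => 1).
    + apply cb_wallis.
    + replace 1 with (1 - 0) at 1 by ring.
      apply is_lim_seq_minus'; [apply is_lim_seq_const|apply lim_inv_lin; lra].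
    + apply is_lim_seq_const.
Qed.

(** * Asymptotics of the central Delannoy numbers *)

Definition al : R := 3 + 2 * sqrt 2.
Definition be : R := 3 - 2 * sqrt 2.

Lemma sqrt2_sq : sqrt 2 * sqrt 2 = 2.
Proof. apply sqrt_sqrt; lra. Qed.

Lemma sqrt2_bound : 1.41 < sqrt 2 < 1.42.
Proof.
  pose proof sqrt2_sq; assert (0 <= sqrt 2) by apply sqrt_pos; split; nra.
Qed.

Lemma al_be : al * be = 1.
Proof. unfold al, be; pose proof sqrt2_sq; nra. Qed.

Lemma al_pos : 0 < al.
Proof. unfold al; pose proof sqrt2_bound; lra. Qed.

Lemma be_bound : 0 < be < 0.18.
Proof. unfold be; pose proof sqrt2_bound; lra. Qed.

Lemma gf_cb : gf (/ 2) cb (fun x => / sqrt (1 - x)).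
Proof.
  assert (G : gf (/ 2) cb (PSeries cb)).
  { replace (/ 2) with (/ (Rabs 1 + Rabs 0 + 1)) by (rewrite Rabs_R0, Rabs_R1; field).
    apply gf_of_bound with 1; [rewrite Rabs_R0, Rabs_R1; lra|].
    apply three_term_bound, cb_three_term. }
  apply gf_ext with (3 := G); auto; intros x Hx.
  rewrite (gf_inv_sqrt 1 0 cb (/ 2) (PSeries cb)); auto using cb_three_term.
  - do 2 f_equal; ring.
  - lra.
  - intros y Hy; apply Rabs_def2 in Hy; lra.
Qed.

(** The Cauchy product of the two inverse square roots has terms weighted by [be^k al^(n-k)], which
    equals [al^n be^(2k)] because [al * be = 1]. *)
Lemma delannoy_factor n : dR n = al ^ n * sum_f_R0 (fun k => cb k * (be ^ 2) ^ k * cb (n - k)) n.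
Proof.
  pose proof al_pos as Pa; pose proof be_bound as Pb; pose proof al_be as E.
  assert (Ga : gf rho0 (fun n => cb n * al ^ n) (fun x => / sqrt (1 - al * x))).
  { apply gf_restrict with (/ 2 / al); [|apply (gf_dilate _ al _ _ gf_cb); auto].
    unfold rho0; apply Rmult_le_reg_r with al; auto.
    unfold Rdiv; rewrite Rmult_assoc, Rinv_l by lra.
    unfold al; pose proof sqrt2_bound; lra. }
  assert (Gb : gf rho0 (fun n => cb n * be ^ n) (fun x => / sqrt (1 - be * x))).
  { apply gf_restrict with (/ 2 / be); [|apply (gf_dilate _ be _ _ gf_cb); lra].
    unfold rho0; apply Rmult_le_reg_r with be; [lra|].
    unfold Rdiv; rewrite Rmult_assoc, Rinv_l by lra; lra. }
  rewrite (gf_inj rho0 _ _ _ _ ltac:(unfold rho0; lra) gf_d (gf_mult _ _ _ _ _ Gb Ga)).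
  - unfold PS_mult; rewrite scal_sum; apply sum_eq; intros k Hk.
    replace (al ^ n) with (al ^ k * al ^ (n - k)) by (rewrite <- pow_add; f_equal; lia).
    replace ((be ^ 2) ^ k) with (be ^ k * be ^ k) by (rewrite <- Rpow_mult_distr; f_equal; ring).
    assert (Ek : al ^ k * be ^ k = 1) by (rewrite <- Rpow_mult_distr, E; apply pow1).
    transitivity (cb k * be ^ k * cb (n - k) * al ^ (n - k) * 1); [ring|rewrite <- Ek; ring].
  - intros x Hx; unfold rho0 in Hx; apply Rabs_def2 in Hx; unfold sq.
    assert (al < 6) by (unfold al; pose proof sqrt2_bound; lra).
    rewrite <- Rinv_mult, <- sqrt_mult by nra; do 2 f_equal.
    unfold al, be; pose proof sqrt2_sq; nra.
Qed.

Lemma cb_decr m j : cb (m + j) <= cb m.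
Proof.
  induction j as [|j IH]; [rewrite Nat.add_0_r; lra|].
  rewrite Nat.add_succ_r; cbn [cb]; pose proof (cb_pos (m + j)); pose proof (pos_INR (m + j)).
  assert ((INR (m + j) + / 2) / (INR (m + j) + 1) <= 1); [|nra].
  apply Rmult_le_reg_r with (INR (m + j) + 1); [lra|].
  unfold Rdiv; rewrite Rmult_assoc, Rinv_l; lra.
Qed.

Lemma pow4_ge j : 1 + INR j <= 4 ^ j.
Proof. induction j as [|j IH]; [simpl; lra|]; rewrite S_INR; pose proof (pos_INR j); simpl; lra. Qed.

(* The growth factor [4 ^ j] is harmless since [4 * be ^ 2 < 1]. *)
Lemma cb_growth j m : (0 < m + j)%nat -> cb m <= cb (m + j) * (1 + 4 ^ j * / INR (m + j)).
Proof.
  revert m; induction j as [|j IH]; intros m Hn.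
  - rewrite Nat.add_0_r in *; pose proof (cb_pos m); pose proof (lt_0_INR m Hn) as P.
    apply Rinv_0_lt_compat in P; simpl; nra.
  - replace (m + S j)%nat with (S m + j)%nat by lia.
    pose proof (IH (S m) ltac:(lia)) as I.
    assert (Pn : 0 < INR (S m + j)) by (apply lt_0_INR; lia).
    set (N := INR (S m + j)) in *.
    assert (EN : N = INR m + 1 + INR j) by (unfold N; rewrite plus_INR, S_INR; ring).
    pose proof (pos_INR m) as Pm; pose proof (pos_INR j) as Pj; pose proof (pow4_ge j) as P4.
    pose proof (cb_pos (S m + j)) as Pc.
    assert (E : cb m = cb (S m) * ((2 * INR m + 2) / (2 * INR m + 1))) by (cbn [cb]; field; lra).
    rewrite E.
    apply Rle_trans with (cb (S m + j) * (1 + 4 ^ j * / N) * ((2 * INR m + 2) / (2 * INR m + 1))).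
    { apply Rmult_le_compat_r; auto; apply Rlt_le, Rdiv_lt_0_compat; lra. }
    rewrite Rmult_assoc; apply Rmult_le_compat_l; [lra|].
    apply Rmult_le_reg_r with (N * (2 * INR m + 1)); [nra|].
    replace ((1 + 4 ^ j * / N) * ((2 * INR m + 2) / (2 * INR m + 1)) * (N * (2 * INR m + 1)))
      with ((N + 4 ^ j) * (2 * INR m + 2)) by (field; lra).
    replace ((1 + 4 ^ S j * / N) * (N * (2 * INR m + 1)))
      with ((N + 4 * 4 ^ j) * (2 * INR m + 1)) by (simpl; field; lra).
    (* What is left amounts to m + 1 + j <= 4^j (6m + 2), a consequence of [pow4_ge]. *)
    rewrite EN; nra.
Qed.

Lemma lim_sum_cb x : Rabs x < / 2 ->
  is_lim_seq (fun n => sum_f_R0 (fun k => cb k * x ^ k) n) (/ sqrt (1 - x)).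
Proof.
  intros Hx; apply is_lim_seq_Reals.
  exact (proj1 (is_series_Reals _ _) (proj1 (is_pseries_R _ _ _) (gf_cb x Hx))).
Qed.

Definition gsum (n : nat) : R := sum_f_R0 (fun k => cb k * (be ^ 2) ^ k * cb (n - k)) n / cb n.

(** Squeeze: cb(n-k)/cb(n) lies between 1 and 1 + 4^k/n. The error is 1/n times a partial sum at
    [4 * be^2 < 0.16], inside the disc of [gf_cb], so it vanishes. *)
Lemma lim_gsum : is_lim_seq gsum (/ sqrt (1 - be ^ 2)).
Proof.
  pose proof be_bound as Pb.
  assert (B2 : 0 < be ^ 2 < 0.04) by nra.
  assert (Pk : forall k, 0 <= cb k * (be ^ 2) ^ k).
  { intros k; apply Rmult_le_pos; [apply Rlt_le, cb_pos|apply pow_le; lra]. }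
  apply is_lim_seq_le_le_loc with
    (fun n => sum_f_R0 (fun k => cb k * (be ^ 2) ^ k) n)
    (fun n => sum_f_R0 (fun k => cb k * (be ^ 2) ^ k) n
              + / INR n * sum_f_R0 (fun k => cb k * (4 * be ^ 2) ^ k) n).
  - exists 1%nat; intros n Hn; pose proof (cb_pos n) as Pc; unfold gsum.
    split; apply Rmult_le_reg_r with (cb n); auto;
      unfold Rdiv; rewrite (Rmult_assoc (sum_f_R0 _ n) (/ cb n)), Rinv_l, Rmult_1_r by lra.
    + rewrite Rmult_comm, scal_sum; apply sum_Rle; intros k Hk.
      apply Rmult_le_compat_l; auto.
      pose proof (cb_decr (n - k) k) as D; replace (n - k + k)%nat with n in D by lia; auto.
    + rewrite Rmult_comm, scal_sum, <- sum_plus, scal_sum; apply sum_Rle; intros k Hk.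
      pose proof (cb_growth k (n - k) ltac:(lia)) as D.
      replace (n - k + k)%nat with n in D by lia.
      rewrite Rpow_mult_distr.
      apply Rle_trans with (cb k * (be ^ 2) ^ k * (cb n * (1 + 4 ^ k * / INR n))).
      * apply Rmult_le_compat_l; auto.
      * apply Req_le; ring.
  - apply lim_sum_cb; rewrite Rabs_pos_eq; lra.
  - replace (/ sqrt (1 - be ^ 2)) with (/ sqrt (1 - be ^ 2) + 0 * / sqrt (1 - 4 * be ^ 2)) by ring.
    apply is_lim_seq_plus'; [apply lim_sum_cb; rewrite Rabs_pos_eq; lra|].
    apply is_lim_seq_mult'; [apply lim_inv_INR|apply lim_sum_cb; rewrite Rabs_pos_eq; lra].
Qed.

Lemma delannoy_gsum n : dR n = al ^ n * (gsum n * cb n).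
Proof. rewrite delannoy_factor; unfold gsum; f_equal; field; pose proof (cb_pos n); lra. Qed.

Lemma dR_pos n : 0 < dR n.
Proof.
  apply (lt_INR 0); unfold delannoy; cbn [seq map fold_right]; rewrite !binom_0; lia.
Qed.

Lemma rR_pos n : 0 < rR n.
Proof.
  apply (lt_INR 0); induction n as [|n IH]; [unfold schroder_r; simpl; lia|].
  rewrite schroder_r_succ; lia.
Qed.

Lemma lim_delannoy : is_lim_seq (fun n => dR n * sqrt (INR n * PI) / al ^ n) (/ sqrt (1 - be ^ 2)).
Proof.
  apply is_lim_seq_ext with (fun n => gsum n * (cb n * sqrt (INR n * PI))).
  { intros n; rewrite delannoy_gsum; pose proof (pow_lt al n al_pos); field; lra. }
  replace (/ sqrt (1 - be ^ 2)) with (/ sqrt (1 - be ^ 2) * 1) by ring.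
  apply is_lim_seq_mult'; [apply lim_gsum|apply lim_cb].
Qed.

Lemma lim_delannoy_ratio : is_lim_seq (fun n => dR n / dR (S n)) be.
Proof.
  pose proof be_bound as Pb; pose proof al_pos as Pa.
  assert (S0 : 0 < sqrt (1 - be ^ 2)) by (apply sqrt_lt_R0; nra).
  assert (Pg : forall n, 0 < gsum n).
  { intros n; pose proof (dR_pos n) as Pd; rewrite delannoy_gsum in Pd.
    pose proof (cb_pos n); pose proof (pow_lt al n Pa).
    destruct (Rlt_le_dec 0 (gsum n)) as [|L]; auto.
    assert (gsum n * cb n <= 0) by nra; nra. }
  (* The last factor is cb(n)/cb(n+1) = (2n+2)/(2n+1). *)
  apply is_lim_seq_ext with (fun n => be * (gsum n / gsum (S n)) * (1 + / (2 * INR n + 1))).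
  { intros n; rewrite !delannoy_gsum; cbn [cb pow].
    pose proof (cb_pos n); pose proof (pow_lt al n Pa); pose proof (Pg (S n)); pose proof (pos_INR n).
    replace be with (/ al) by (apply Rmult_eq_reg_l with al; [rewrite al_be; field|]; lra).
    field; repeat split; lra. }
  replace be with (be * (/ sqrt (1 - be ^ 2) / / sqrt (1 - be ^ 2)) * (1 + 0)) at 1 by (field; lra).
  apply is_lim_seq_mult'; [apply is_lim_seq_mult'; [apply is_lim_seq_const|]|].
  - apply is_lim_seq_div'; [apply lim_gsum|apply (proj1 (is_lim_seq_incr_1 gsum _)), lim_gsum|].
    apply Rgt_not_eq, Rinv_0_lt_compat; auto.
  - apply is_lim_seq_plus'; [apply is_lim_seq_const|apply lim_inv_lin; lra].
Qed.

(** From 2(n+2) r_(n+1) = 3 d_(n+1) - d_n the limit is (3 - be)/2, which is the square root of 2. *)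
Lemma lim_schroder_delannoy : is_lim_seq (fun n => rR n / dR n * INR n) (sqrt 2).
Proof.
  apply is_lim_seq_incr_1.
  apply is_lim_seq_ext with (fun n => (3 - dR n / dR (S n)) * / 2 * (1 - / (1 * INR n + 2))).
  { intros n; pose proof (schroder_delannoy n) as E; pose proof (dR_pos (S n)); pose proof (pos_INR n).
    rewrite S_INR in *.
    replace (rR (S n)) with ((3 * dR (S n) - dR n) / (2 * (INR n + 1 + 1))) by (rewrite <- E; field; lra).
    field; lra. }
  replace (sqrt 2) with ((3 - be) * / 2 * (1 - 0)) by (unfold be; field).
  apply is_lim_seq_mult'; [apply is_lim_seq_mult'|].
  - apply is_lim_seq_minus'; [apply is_lim_seq_const|apply lim_delannoy_ratio].
  - apply is_lim_seq_const.
  - apply is_lim_seq_minus'; [apply is_lim_seq_const|apply lim_inv_lin; lra].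
Qed.

Lemma lim_schroder_delannoy_0 : is_lim_seq (fun n => rR n / dR n) 0.
Proof.
  apply is_lim_seq_incr_1.
  apply is_lim_seq_ext with (fun n => rR (S n) / dR (S n) * INR (S n) * / INR (S n)).
  { intros n; pose proof (dR_pos (S n)); rewrite S_INR; pose proof (pos_INR n); field; lra. }
  replace 0 with (sqrt 2 * 0) by ring; apply is_lim_seq_mult'.
  - apply (proj1 (is_lim_seq_incr_1 (fun n => rR n / dR n * INR n) _)), lim_schroder_delannoy.
  - apply (proj1 (is_lim_seq_incr_1 (fun n => / INR n) _)), lim_inv_INR.
Qed.

(** Against [dR n] the Schröder terms are negligible, and only 1 minus the limit ratio of
    consecutive Delannoy numbers survives. *)
Lemma lim_ell_delannoy : is_lim_seq (fun n => eR n / dR n) (1 - be).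
Proof.
  apply is_lim_seq_incr_1.
  apply is_lim_seq_ext with
    (fun n => 1 - rR (S n) / dR (S n) - (dR n / dR (S n) - rR n / dR n * (dR n / dR (S n)))).
  { intros n; rewrite ell_delannoy; simpl pshift.
    pose proof (dR_pos (S n)); pose proof (dR_pos n); field; lra. }
  replace (1 - be) with (1 - 0 - (be - 0 * be)) by ring.
  apply is_lim_seq_minus'; apply is_lim_seq_minus'.
  - apply is_lim_seq_const.
  - apply (proj1 (is_lim_seq_incr_1 (fun n => rR n / dR n) _)), lim_schroder_delannoy_0.
  - apply lim_delannoy_ratio.
  - apply is_lim_seq_mult'; [apply lim_schroder_delannoy_0|apply lim_delannoy_ratio].
Qed.

Lemma lim_ell : is_lim_seq
  (fun n => INR (ell n) / ((1 + sqrt 2) ^ (2 * n) / sqrt (sqrt 2 * INR n * PI))) 1.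
Proof.
  pose proof sqrt2_bound as B; pose proof PI_RGT_0 as HPI; pose proof be_bound as Pb.
  apply is_lim_seq_incr_1.
  apply is_lim_seq_ext with (fun n => eR (S n) / dR (S n) *
    (dR (S n) * sqrt (INR (S n) * PI) / al ^ S n) * sqrt (sqrt 2)).
  { intros n; pose proof (dR_pos (S n)); pose proof (pow_lt al (S n) al_pos).
    assert (0 < INR (S n)) by (apply lt_0_INR; lia).
    rewrite pow_mult; replace ((1 + sqrt 2) ^ 2) with al by (unfold al; pose proof sqrt2_sq; nra).
    replace (sqrt (sqrt 2 * INR (S n) * PI)) with (sqrt (sqrt 2) * sqrt (INR (S n) * PI))
      by (rewrite Rmult_assoc, (sqrt_mult (sqrt 2)) by nra; reflexivity).
    unfold eR.
    assert (0 < sqrt (sqrt 2)) by (apply sqrt_lt_R0; lra).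
    assert (0 < sqrt (INR (S n) * PI)) by (apply sqrt_lt_R0; nra).
    field; lra. }
  assert (S0 : 0 < 1 - be ^ 2) by nra.
  (* Squared, this is (1 - be)^2 sqrt 2 = 1 - be^2; both sides equal 12 sqrt 2 - 16. *)
  assert (E : 1 = (1 - be) * / sqrt (1 - be ^ 2) * sqrt (sqrt 2)).
  { pose proof (sqrt_lt_R0 _ S0) as S1.
    assert (S2 : 0 < sqrt (sqrt 2)) by (apply sqrt_lt_R0; lra).
    apply Rmult_eq_reg_r with (sqrt (1 - be ^ 2)); [|lra].
    replace ((1 - be) * / sqrt (1 - be ^ 2) * sqrt (sqrt 2) * sqrt (1 - be ^ 2))
      with ((1 - be) * sqrt (sqrt 2)) by (field; lra).
    rewrite Rmult_1_l; apply Rsqr_inj; [lra|nra|].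
    rewrite Rsqr_mult, !Rsqr_sqrt by lra; unfold Rsqr, be; pose proof sqrt2_sq; nra. }
  rewrite E; apply is_lim_seq_mult'; [apply is_lim_seq_mult'|apply is_lim_seq_const].
  - apply (proj1 (is_lim_seq_incr_1 (fun n => eR n / dR n) _)), lim_ell_delannoy.
  - apply (proj1 (is_lim_seq_incr_1 (fun n => dR n * sqrt (INR n * PI) / al ^ n) _)), lim_delannoy.
Qed.

Lemma lim_index : is_lim_seq
  (fun n => (INR (ell n) / INR (schroder_r n)) / ((2 - sqrt 2) * INR n)) 1.
Proof.
  pose proof sqrt2_bound as B; pose proof sqrt2_sq as Q.
  apply is_lim_seq_incr_1.
  apply is_lim_seq_ext with (fun n => eR (S n) / dR (S n) /
    (rR (S n) / dR (S n) * INR (S n) * (2 - sqrt 2))).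
  { intros n; pose proof (dR_pos (S n)); pose proof (rR_pos (S n)).
    assert (0 < INR (S n)) by (apply lt_0_INR; lia).
    fold (eR (S n)); fold (rR (S n)); field; repeat split; lra. }
  (* Indeed 1 - be = 2 sqrt 2 - 2 = sqrt 2 (2 - sqrt 2). *)
  replace 1 with ((1 - be) / (sqrt 2 * (2 - sqrt 2))).
  - apply is_lim_seq_div'; [|apply is_lim_seq_mult'; [|apply is_lim_seq_const]|nra].
    + apply (proj1 (is_lim_seq_incr_1 (fun n => eR n / dR n) _)), lim_ell_delannoy.
    + apply (proj1 (is_lim_seq_incr_1 (fun n => rR n / dR n * INR n) _)), lim_schroder_delannoy.
  - apply Rmult_eq_reg_r with (sqrt 2 * (2 - sqrt 2)); [|nra].
    unfold Rdiv; rewrite Rmult_assoc, Rinv_l by nra; unfold be; nra.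
Qed.

Theorem mainTheorem13 :
  (exists rho : R, 0 < rho /\
     forall x : R, 0 < Rabs x < rho ->
       infinite_sum (fun n => INR (ell n) * x ^ n) (edge_gf x))
  /\ (forall n : nat, (1 <= n)%nat ->
        Z.of_nat (ell n) =
          (Z.of_nat (delannoy n) - Z.of_nat (schroder_r n)
           - Z.of_nat (delannoy (n - 1)) + Z.of_nat (schroder_r (n - 1)))%Z)
  /\ (forall n : nat,
        INR (ell n) =
          sum_f_R0 (fun k => multichoose (2 * k) (n - k) * Binomial.C (2 * k) k
                             * (INR k / INR (k + 1))) n)
  /\ Un_cv (fun n => INR (ell n)
                     / ((1 + sqrt 2) ^ (2 * n) / sqrt (sqrt 2 * INR n * PI))) 1
  /\ Un_cv (fun n => (INR (ell n) / INR (schroder_r n)) / ((2 - sqrt 2) * INR n)) 1.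
Proof.
  split; [|split; [|split; [|split]]].
  - exists rho0; split; [unfold rho0; lra|]; intros x [Px Hx].
    rewrite edge_gf_ef by (auto; intros ->; rewrite Rabs_R0 in Px; lra).
    apply is_series_Reals, is_pseries_R, gf_e, Hx.
  - intros [|n] Hn; [lia|]; replace (S n - 1)%nat with n by lia.
    pose proof (ell_delannoy (S n)) as E; unfold eR, dR, rR in E; simpl pshift in E.
    apply eq_IZR; rewrite plus_IZR, !minus_IZR, <- !INR_IZR_INZ; lra.
  - exact ell_sum.
  - apply is_lim_seq_Reals, lim_ell.
  - apply is_lim_seq_Reals, lim_index.
Qed.
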